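(* Let $X$ be an infinite-dimensional complex Banach space, let $T$ be a bounded linear operator on $X$, and let $F$ be a (bounded) finite rank operator on $X$ such that $TF=FT$. Then $$\sigma_{lgD}(T+F)=\sigma_{lgD}(T).$$
   Context: The quasinilpotent part of a bounded operator $S$ on $X$ is $H_0(S)=\{x\in X:\lim_{n\to\infty}\|S^nx\|^{1/n}=0\}$. $S$ is left generalized Drazin invertible if $H_0(S)$ is closed and there is a closed subspace $M$ of $X$ with $X=M\oplus H_0(S)$, $S(M)\subset M$ and $S(M)$ closed. The left generalized Drazin spectrum is $\sigma_{lgD}(S)=\{\lambda\in\mathbb{C}:\lambda I-S\text{ is not left generalized Drazin invertible}\}$. *)

(* Defs.v *)
From HB Require Import structures.
From mathcomp Require Import all_boot all_order all_algebra.
From mathcomp Require Import complex.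
From mathcomp Require Import all_classical all_reals all_analysis.

Set Implicit Arguments.
Unset Strict Implicit.
Unset Printing Implicit Defensive.

Import Order.TTheory GRing.Theory Num.Theory.
Import numFieldNormedType.Exports.

Local Open Scope classical_set_scope.
Local Open Scope ring_scope.
Local Open Scope complex_scope.

Section LeftGeneralizedDrazin.
Context {R : realType} {X : completeNormedModType R[i]}.
Implicit Types (S : X -> X) (M N A : set X).

(* For linear S; since the norm of X takes its values in the nonnegative reals
   of R[i], the inequality forces c to be real and nonnegative (unless X = 0). *)
Definition bounded_operator S : Prop :=
  exists c : R[i], forall x : X, `|S x| <= c * `|x|.

Definition linear_subspace A : Prop := submod_closed (mem A).

Definition finite_dimensional A : Prop :=
  exists (n : nat) (v : 'I_n -> X),
    A = [set \sum_(i < n) c i *: v i | c in [set: 'I_n -> R[i]]].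

Definition finite_rank S : Prop := finite_dimensional (range S).

Definition direct_sum M N : Prop :=
  M `&` N = [set 0] /\
  forall x : X, exists m n : X, [/\ M m, N n & x = m + n].

(* n.-root is the nonnegative n-th root on nonnegative reals; its value at
   n = 0 does not affect the limit. *)
Definition quasinilpotent_part S : set X :=
  [set x | (n.-root `|iter n S x|) @[n --> \oo] --> (0 : R[i]^o)].

Definition lgD_invertible S : Prop :=
  closed (quasinilpotent_part S) /\
  exists M : set X,
    [/\ linear_subspace M, closed M, direct_sum M (quasinilpotent_part S),
        S @` M `<=` M & closed (S @` M)].

Definition lgD_spectrum S : set R[i] :=
  [set lambda | ~ lgD_invertible (fun x => lambda *: x - S x)].

End LeftGeneralizedDrazin.

(* Main.v *)
Require Import Defs.
From HB Require Import structures.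
From mathcomp Require Import all_boot all_order all_algebra.
From mathcomp Require Import complex.
From mathcomp Require Import all_classical all_reals all_analysis.
From mathcomp Require Import ring lra.

Set Implicit Arguments.
Unset Strict Implicit.
Unset Printing Implicit Defensive.

Import Order.TTheory GRing.Theory Num.Theory.
Import numFieldNormedType.Exports.

Local Open Scope classical_set_scope.
Local Open Scope ring_scope.
Local Open Scope complex_scope.

(** The proof replaces left generalized Drazin invertibility by an operator
    statement: S is left generalized Drazin invertible if and only if there is
    a bounded projection P commuting with S, with range inside H_0(S), such
    that S is bounded below on ker P (lgD_projection_invertible and
    lgD_invertible_projection).  Passing from the subspaces to P uses the closed
    graph theorem twice: for the projection along M, and for the inverse of the
    restriction of S to M, which is injective because ker S lies in H_0(S).

    So let P be such a projection for S, and let F have finite rank and commute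
    with S.  By Cayley-Hamilton on the range of F there are k and a polynomial U
    in F with F^k = F^(k+1) U, and this gives a finite-rank
    projection pi, commuting with everything that commutes with F, such that F
    is nilpotent on ker pi (fitting_projection).

    On the finite-dimensional range of pi the operator S + F is arbitrary, and
    its own Fitting decomposition splits it into a nilpotent and an invertible
    part.  On ker pi, with Q the projection induced by P, the commuting nilpotent
    F changes neither H_0 nor boundedness below; but ker Q need not be invariant
    under F, so Q has to be replaced by a projection Q - Z(1 - Q) commuting
    with S + F.  Here Z has to solve the Sylvester equation
    Z B = (S + F) Z + Q F on ker Q, where B is the compression of S + F to ker Q
    and is bounded below.  The range of B need not be complemented, but Q F has
    finite rank: it is a sum of terms g(x) w with g a bounded functional, and the
    Hahn-Banach theorem extends the functionals g o B^(-1) from the range of B to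
    the whole space (finite_rank_extension).  Moreover S is nilpotent on the
    range of Q F, which is finite-dimensional, invariant and contained in H_0(S),
    so that the usual series for Z is a finite sum (nilpotent_perturbation).

    Invertibility of lambda - T thus passes to lambda - T - F, and the converse
    is the same statement for the perturbation F of lambda - T - F. *)

(** * The real-valued norm and sequences *)

Section RealNorm.
Context {R : realType}.

(** The norm of V takes values in R[i], where the order is partial; its real
    part lets estimates be carried out in R. *)
Definition rnorm {V : normedZmodType R[i]} (x : V) : R := complex.Re `|x|.

Section NormedZmodule.
Context {V : normedZmodType R[i]}.
Implicit Types x y : V.

Lemma rnormE x : `|x| = (rnorm x)%:C.
Proof. by rewrite /rnorm RRe_real // normr_real. Qed.

Lemma rnorm_ge0 x : 0 <= rnorm x.
Proof. by rewrite -ler0c -rnormE. Qed.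

Lemma rnorm0 : rnorm (0 : V) = 0.
Proof. by rewrite /rnorm normr0. Qed.

Lemma rnorm0_eq0 x : rnorm x = 0 -> x = 0.
Proof. by move=> x0; apply/eqP; rewrite -normr_eq0 rnormE x0. Qed.

Lemma rnormN x : rnorm (- x) = rnorm x.
Proof. by rewrite /rnorm normrN. Qed.

Lemma rnormB x y : rnorm (x - y) = rnorm (y - x).
Proof. by rewrite -rnormN opprB. Qed.

Lemma rnormD x y : rnorm (x + y) <= rnorm x + rnorm y.
Proof. by rewrite -lecR rmorphD /= -!rnormE ler_normD. Qed.

Lemma rnorm_sub x y : rnorm (x - y) <= rnorm x + rnorm y.
Proof. by rewrite -(rnormN y) rnormD. Qed.

Lemma rnorm_dist x y z : rnorm (x - z) <= rnorm (x - y) + rnorm (y - z).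
Proof. by rewrite (le_trans _ (rnormD _ _)) // addrA subrK. Qed.

Lemma rnorm_small0 x (c : R) : (forall e, 0 < e -> rnorm x <= c * e) -> x = 0.
Proof.
move=> xe; apply/rnorm0_eq0/eqP; rewrite eq_le rnorm_ge0 andbT.
apply/ler_addgt0Pl => e e0; rewrite addr0.
have c1 : 0 < `|c| + 1 by rewrite ltr_wpDl.
rewrite (le_trans (xe (e / (`|c| + 1)) _)) ?divr_gt0//.
rewrite mulrCA ger_pMr// ler_pdivrMr// mul1r.
by rewrite (le_trans (ler_norm c))// lerDl.
Qed.

End NormedZmodule.

Lemma rnorm_real (t : R) : rnorm (t%:C : R[i]) = `|t|.
Proof. by rewrite /rnorm normc_def /= expr0n /= addr0 sqrtr_sqr. Qed.

Lemma Re_le_rnorm (a : R[i]) : `|complex.Re a| <= rnorm a.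
Proof. by rewrite -lecR -rnormE normc_ge_Re. Qed.

Lemma rnorm_le_ReIm (a : R[i]) :
  rnorm a <= `|complex.Re a| + `|complex.Im a|.
Proof.
rewrite {1}[a]complexE (le_trans (rnormD _ _))// rnorm_real lerD2l.
rewrite -lecR -rnormE normrM [X in _ * X]rnormE rnorm_real.
by rewrite normc_def /= expr0n expr1n add0r sqrtr1 mul1r.
Qed.

Section NormedModule.
Context {V : normedModType R[i]}.
Implicit Types x y : V.

Lemma rnormZ (a : R[i]) x : rnorm (a *: x) = rnorm a * rnorm x.
Proof. by apply: complexI; rewrite rmorphM /= -!rnormE normrZ. Qed.

Lemma rnormZr (t : R) x : rnorm (t%:C *: x) = `|t| * rnorm x.
Proof. by rewrite rnormZ rnorm_real. Qed.

Definition tends (u : nat -> V) (l : V) : Prop :=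
  forall e : R, 0 < e -> exists N, forall n, (N <= n)%N -> rnorm (u n - l) <= e.

Lemma tends_cvg (u : nat -> V) (l : V) : u @ \oo --> l -> tends u l.
Proof.
move=> /cvgrPdist_le ul e e0.
have [|N _ uN] := ul e%:C; first by rewrite ltcR.
by exists N => n /uN /=; rewrite rnormB rnormE lecR.
Qed.

Lemma closed_approx (A : set V) x : closed A ->
  (forall e : R, 0 < e -> exists2 a, A a & rnorm (x - a) <= e) -> A x.
Proof.
move=> cA xA; apply: cA => B /nbhs_ballP[e /= e0 eB].
have eE : e = (complex.Re e)%:C by rewrite RRe_real// realE ltW.
have {}e0 : 0 < complex.Re e by rewrite -ltcR -eE.
have [|a Aa xa] := xA (complex.Re e / 2); first by rewrite divr_gt0.
exists a; split => //; apply: eB; rewrite -ball_normE /= eE rnormE ltcR.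
by rewrite (le_lt_trans xa)// ltr_pdivrMr// ltr_pMr// ltr1n.
Qed.

Lemma approx_closed (A : set V) :
  (forall x, (forall e : R, 0 < e -> exists2 a, A a & rnorm (x - a) <= e) -> A x) ->
  closed A.
Proof.
move=> hA x clx; apply: hA => e e0.
have [|a [Aa]] := clx (ball x e%:C); first by apply: nbhsx_ballx; rewrite ltcR.
by rewrite -ball_normE /= rnormE ltcR => /ltW xa; exists a.
Qed.

Lemma closed_tends (A : set V) u l :
  closed A -> (forall n, A (u n)) -> tends u l -> A l.
Proof.
move=> cA Au ul; apply: (closed_approx cA) => e /ul[N uN].
by exists (u N) => //; rewrite rnormB uN.
Qed.

Lemma tends_unique u l m : tends u l -> tends u m -> l = m.
Proof.
move=> ul um; apply/subr0_eq/(@rnorm_small0 _ _ 2) => e e0.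
have [N uN] := ul e e0; have [M uM] := um e e0.
have := uN _ (leq_maxl N M); have := uM _ (leq_maxr N M).
have := rnorm_dist l (u (maxn N M)) m; rewrite (rnormB l (u _)); lra.
Qed.

Lemma tends_sub u v l m :
  tends u l -> tends v m -> tends (fun n => u n - v n) (l - m).
Proof.
move=> ul vm e e0.
have e2 : 0 < e / 2 by rewrite divr_gt0.
have [N uN] := ul _ e2; have [M vM] := vm _ e2.
exists (maxn N M) => n; rewrite geq_max => /andP[/uN un /vM vn].
rewrite opprD addrACA -opprD (le_trans (rnorm_sub _ _))//; lra.
Qed.

Lemma rnorm_tends_le u l (b : R) :
  (forall n, rnorm (u n) <= b) -> tends u l -> rnorm l <= b.
Proof.
move=> ub ul; apply/ler_addgt0Pl => e /ul[N /(_ _ (leqnn N))].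
have := ub N; have := rnormD (l - u N) (u N); rewrite subrK rnormB; lra.
Qed.

End NormedModule.

Lemma tends_cauchy {V : completeNormedModType R[i]} (u : nat -> V) :
  (forall e : R, 0 < e -> exists N, forall n, (N <= n)%N ->
     rnorm (u n - u N) <= e) ->
  exists l, tends u l.
Proof.
move=> cu; suff /cauchy_cvgP/cvg_ex[l /tends_cvg ul] : cauchy (u @ \oo).
  by exists l.
apply: cauchy_exP => e e0.
have eE : e = (complex.Re e)%:C by rewrite RRe_real// realE ltW.
have {}e0 : 0 < complex.Re e by rewrite -ltcR -eE.
have [|N uN] := cu (complex.Re e / 2); first by rewrite divr_gt0.
exists (u N), N => // n /= /uN un; rewrite /= -ball_normE /= eE rnormE ltcR.
by rewrite rnormB (le_lt_trans un)// ltr_pdivrMr// ltr_pMr// ltr1n.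
Qed.

(** The form in which completeness is used: the Baire argument, the iteration
    in the closed graph theorem and the closed-image lemma all produce sequences
    with geometrically small increments. *)
Lemma tends_geometric {V : completeNormedModType R[i]} (u : nat -> V) (b : R) :
  0 <= b -> (forall n, rnorm (u n.+1 - u n) <= b / 2 ^+ n) ->
  exists2 l, tends u l & rnorm (l - u 0%N) <= 2 * b.
Proof.
move=> b0 ub.
have step n k : rnorm (u (n + k)%N - u n) <= 2 * b / 2 ^+ n - 2 * b / 2 ^+ (n + k).
  elim: k => [|k IH]; first by rewrite addn0 !subrr rnorm0.
  rewrite (le_trans (rnorm_dist _ (u (n + k)%N) _))//.
  have := ub (n + k)%N; rewrite addnS.
  have -> : b / 2 ^+ (n + k) = 2 * b / 2 ^+ (n + k) - 2 * b / 2 ^+ (n + k).+1.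
    rewrite exprS; field; exact: lt0r_neq0 (exprn_gt0 _ _).
  by move: IH; lra.
have step2 n k : rnorm (u (n + k)%N - u n) <= 2 * b / 2 ^+ n.
  by rewrite (le_trans (step n k))// gerBl divr_ge0 ?mulr_ge0 ?exprn_ge0.
have [l ul] : exists l, tends u l.
  apply: tends_cauchy => e e0.
  have /cvgrPdist_le/(_ e e0)[N _ /(_ N (leqnn N))] : geometric (2 * b) (2^-1 : R) @ \oo --> (0 : R).
    by apply: cvg_geometric; rewrite ger0_norm ?invr_ge0// invf_lt1// ltr1n.
  rewrite /= sub0r normrN exprVn => /(le_trans (ler_norm _)) hN.
  exists N => n /subnKC <-; exact: le_trans (step2 _ _) hN.
exists l => //; apply: (rnorm_tends_le (u := fun n => u n - u 0%N)).
  by move=> n; have := step2 0%N n; rewrite expr0 divr1.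
by apply: tends_sub ul _ => e e0; exists 0%N => n _; rewrite subrr rnorm0 ltW.
Qed.

End RealNorm.

(** * The closed graph theorem on a closed subspace *)

Section Subspace.
Context {R : realType} {X : completeNormedModType R[i]}.
Variables (A : set X) (linA : linear_subspace A).

Lemma subspace_comb (a : R[i]) x y : A x -> A y -> A (a *: x + y).
Proof.
case: linA => _ /(_ a x y) h Ax Ay.
by have := h (mem_set Ax) (mem_set Ay); rewrite inE.
Qed.

Lemma subspace0 : A 0.
Proof. by case: linA => + _; rewrite inE. Qed.

Lemma subspaceD x y : A x -> A y -> A (x + y).
Proof. by move=> Ax Ay; rewrite -[x]scale1r; exact: subspace_comb. Qed.

Lemma subspaceZ (a : R[i]) x : A x -> A (a *: x).
Proof. by move=> Ax; rewrite -[_ *: _]addr0; apply: subspace_comb; last exact: subspace0. Qed.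

Lemma subspaceB x y : A x -> A y -> A (x - y).
Proof. by move=> Ax Ay; rewrite addrC -scaleN1r; exact: subspace_comb. Qed.

End Subspace.

Section ClosedGraph.
Context {R : realType} {X : completeNormedModType R[i]}.
Variables (N : set X) (G : X -> X).
Hypotheses (closedN : closed N) (linN : linear_subspace N).
Hypothesis linG :
  forall (a : R[i]) x y, N x -> N y -> G (a *: x + y) = a *: G x + G y.
Hypothesis closedG : forall u l m, (forall n, N (u n)) ->
  tends u l -> tends (fun n => G (u n)) m -> G l = m.

Let G0 : G 0 = 0.
Proof.
have := linG 1 (subspace0 linN) (subspace0 linN).
by rewrite !scale1r addr0 => /esym/eqP; rewrite -subr_eq0 addrK => /eqP.
Qed.

Let GZ (a : R[i]) x : N x -> G (a *: x) = a *: G x.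
Proof. by move=> Nx; rewrite -[_ *: x]addr0 linG ?G0 ?addr0//; exact: subspace0. Qed.

Let GB x y : N x -> N y -> G (x - y) = G x - G y.
Proof. by move=> Nx Ny; rewrite addrC -scaleN1r linG// scaleN1r addrC. Qed.

(** The Baire category argument, run inside the closed subspace: otherwise
    balls could be nested so that the n-th one misses every point of norm at
    most n under G, and their common point would have no image. *)
Lemma image_bounded_dense_in_ball : exists (K : R) (y0 : X) (r : R),
  [/\ 0 <= K, N y0, 0 < r & forall y, N y -> rnorm (y - y0) <= r ->
     forall e : R, 0 < e ->
     exists z, [/\ N z, rnorm (G z) <= K & rnorm (y - z) <= e]].
Proof.
apply: contrapT => nodense.
have next (k : nat) (yr : X * R) : exists yr' : X * R, N yr.1 -> 0 < yr.2 ->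
    [/\ N yr'.1, 0 < yr'.2, rnorm (yr'.1 - yr.1) + yr'.2 <= yr.2,
        yr'.2 <= yr.2 / 2 &
        forall z, N z -> rnorm (yr'.1 - z) <= yr'.2 -> k%:R < rnorm (G z)].
  case: yr => y r /=; case: (pselect (N y)) => [Ny|]; last by exists (y, r).
  have [r0|] := ltP 0 r; last by move=> r0; exists (y, r).
  have : exists y', N y' /\ rnorm (y' - y) <= r / 2 /\ exists2 e : R, 0 < e &
      forall z, N z -> rnorm (y' - z) <= e -> k%:R < rnorm (G z).
    apply: contrapT => nex; apply: nodense; exists k%:R, y, (r / 2).
    split=> //; first by rewrite divr_gt0.
    move=> y' Ny' y'y e e0; apply: contrapT => nz; apply: nex.
    exists y'; split => //; split => //; exists e => // z Nz y'z.
    by rewrite ltNge; apply/negP => Gz; apply: nz; exists z.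
  move=> [y' [Ny' [y'y [e e0 he]]]].
  have [er|re] := leP e (r / 2).
    exists (y', e) => _ _; split => //=; lra.
  exists (y', r / 2) => _ _; split => //=; [lra|lra|].
  by move=> z Nz y'z; apply: he => //; apply: le_trans y'z (ltW re).
have [f fP] := choice (fun kyr : nat * (X * R) => next kyr.1 kyr.2).
(* the n-th step removes from the n-th ball all points z with |G z| <= n *)
pose fix b n : X * R := if n is k.+1 then f (k, b k) else (0, 1).
have bN n : N (b n).1 /\ 0 < (b n).2.
  elim: n => [|n [Nn rn]] /=; first by split; [exact: subspace0|].
  by have [] := fP (n, b n) Nn rn.
have bS n : [/\ rnorm ((b n.+1).1 - (b n).1) + (b n.+1).2 <= (b n).2,
        (b n.+1).2 <= (b n).2 / 2 &
        forall z, N z -> rnorm ((b n.+1).1 - z) <= (b n.+1).2 -> n%:R < rnorm (G z)].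
  by have [Nn rn] := bN n; have [] := fP (n, b n) Nn rn.
have radius n : (b n).2 <= 1 / 2 ^+ n.
  elim: n => [|n IH]; first by rewrite expr0 divr1.
  have [_ h _] := bS n; rewrite exprS invfM mulrCA mulrC.
  by rewrite (le_trans h)// ler_wpM2r// invr_ge0.
have nested n k : rnorm ((b (n + k)%N).1 - (b n).1) + (b (n + k)%N).2 <= (b n).2.
  elim: k => [|k IH]; first by rewrite addn0 subrr rnorm0 add0r.
  have [h _ _] := bS (n + k)%N; rewrite addnS.
  have := rnorm_dist (b (n + k).+1).1 (b (n + k)%N).1 (b n).1; lra.
have [|l ul _] := @tends_geometric _ _ (fun n => (b n).1) 1 ler01.
  move=> n /=; have [h _ _] := bS n; have [_ rn] := bN n.+1.
  have := radius n; lra.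
have Nl : N l by apply: closed_tends ul => // n; case: (bN n).
have lb n : rnorm ((b n).1 - l) <= (b n).2.
  rewrite rnormB; apply: (rnorm_tends_le (u := fun k => (b (n + k)%N).1 - (b n).1)).
    move=> k; have [_ rn] := bN (n + k)%N; have := nested n k; lra.
  apply: tends_sub.
    by move=> e /ul[M uM]; exists M => k Mk; apply: uM; rewrite (leq_trans Mk)// leq_addl.
  by move=> e e0; exists 0%N => k _; rewrite subrr rnorm0 ltW.
have big n : n%:R < rnorm (G l).
  by have [_ _ h] := bS n; apply: h => //.
have := big (Num.truncn (rnorm (G l))).+1; apply/negP; rewrite -leNgt ltW//.
exact: truncnS_gt.
Qed.

(** Differences of two points of the ball cover a ball around 0, and linearity
    rescales it: vectors whose image is controlled by |y| are dense. *)
Lemma approximate_preimage : exists2 C : R, 0 <= C & forall y, N y ->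
  forall e : R, 0 < e ->
  exists z, [/\ N z, rnorm (G z) <= C * rnorm y & rnorm (y - z) <= e].
Proof.
have [K [y0 [r [K0 Ny0 r0 dense]]]] := image_bounded_dense_in_ball.
exists (2 * K / r); first by rewrite divr_ge0// ?mulr_ge0// ltW.
move=> y Ny e e0; have [y_gt0|y_le0] := ltP 0 (rnorm y); last first.
  have -> : y = 0 by apply/rnorm0_eq0/eqP; rewrite eq_le y_le0 rnorm_ge0.
  exists 0; rewrite G0 subrr rnorm0 mulr0 lexx ltW//; split => //; exact: subspace0.
set t := r / rnorm y; have t0 : 0 < t by rewrite divr_gt0.
have te : 0 < t * e / 2 by rewrite divr_gt0// mulr_gt0.
have [||z [Nz Gz yz]] := dense (y0 + t%:C *: y) _ _ (t * e / 2) te.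
- by apply: (subspaceD linN) => //; apply: (subspaceZ linN).
- by rewrite addrC addKr rnormZr gtr0_norm// /t divfK ?gt_eqF.
have [|w [Nw Gw yw]] := dense y0 Ny0 _ (t * e / 2) te.
  by rewrite subrr rnorm0 ltW.
exists ((t^-1)%:C *: (z - w)); split.
- by apply: (subspaceZ linN); apply: (subspaceB linN).
- rewrite GZ; last exact: subspaceB.
  rewrite GB// rnormZr gtr0_norm ?invr_gt0//.
  have -> : 2 * K / r * rnorm y = t^-1 * (2 * K).
    by rewrite /t invfM invrK; ring.
  rewrite ler_pM2l ?invr_gt0// (le_trans (rnorm_sub _ _))//; lra.
have -> : y - (t^-1)%:C *: (z - w) =
    (t^-1)%:C *: ((y0 + t%:C *: y - z) - (y0 - w)).
  rewrite -(addrA y0) (addrC y0) addrKA opprK -addrA (addrC (- z)) -(opprB z w).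
  by rewrite [RHS]scalerBr scalerA -rmorphM mulVf ?gt_eqF// scale1r.
rewrite rnormZr gtr0_norm ?invr_gt0// ler_pdivrMl//.
rewrite (le_trans (rnorm_sub _ _))//; lra.
Qed.

(** Approximating y, then the remainder, and so on with errors halved at each
    step writes y as a series whose images converge absolutely; closedness of
    the graph identifies their sum with G y. *)
Lemma closed_graph : exists2 C : R, 0 <= C &
  forall y, N y -> rnorm (G y) <= C * rnorm y.
Proof.
have [C C0 approx] := approximate_preimage; exists (2 * (C + 1)).
  by rewrite mulr_ge0 ?addr_ge0.
move=> y Ny; have [y_gt0|y_le0] := ltP 0 (rnorm y); last first.
  have -> : y = 0 by apply/rnorm0_eq0/eqP; rewrite eq_le y_le0 rnorm_ge0.
  by rewrite G0 rnorm0 mulr0.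
have next (we : X * R) : exists z, N we.1 -> 0 < we.2 ->
    [/\ N z, rnorm (G z) <= C * rnorm we.1 & rnorm (we.1 - z) <= we.2].
  case: (pselect (N we.1)) => [Nw|nN]; last by exists 0.
  have [e0|e0] := ltP 0 we.2; last by exists 0.
  by have [z zP] := approx _ Nw _ e0; exists z.
have [f fP] := choice next.
pose e n : R := rnorm y / 2 ^+ n.+1.
have e_gt0 n : 0 < e n by rewrite divr_gt0// exprn_gt0.
(* w n is what remains of y after n approximations *)
pose fix w n : X := if n is k.+1 then w k - f (w k, e k) else y.
have wP n : N (w n) /\ rnorm (w n) <= rnorm y / 2 ^+ n.
  elim: n => [|n [Nw wn]] /=; first by rewrite expr0 divr1.
  have [Nz _ h] := fP (w n, e n) Nw (e_gt0 n).
  by split => //; exact: subspaceB.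
have zP n : N (f (w n, e n)) /\ rnorm (G (f (w n, e n))) <= C * rnorm y / 2 ^+ n.
  have [Nw wn] := wP n; have [Nz Gz _] := fP (w n, e n) Nw (e_gt0 n).
  by split => //; rewrite (le_trans Gz)//= -mulrA ler_wpM2l.
have Nu n : N (y - w n) by apply: subspaceB => //; case: (wP n).
have [||l ul lb] := @tends_geometric _ _ (fun n => G (y - w n)) (C * rnorm y).
- by rewrite mulr_ge0// rnorm_ge0.
- move=> n; rewrite -GB//.
  have -> : y - w n.+1 - (y - w n) = f (w n, e n).
    by rewrite /= addrC opprB addrA subrK opprB addrC subrK.
  by have [] := zP n.
have -> : G y = l.
  apply: closedG ul => // d d0.
  have /cvgrPdist_le/(_ d d0)[M _ hM] : geometric (rnorm y) (2^-1 : R) @ \oo --> (0 : R).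
    by apply: cvg_geometric; rewrite ger0_norm ?invr_ge0// invf_lt1// ltr1n.
  exists M => n /hM; rewrite /= sub0r normrN exprVn => /(le_trans (ler_norm _)).
  apply: le_trans; rewrite addrAC subrr add0r rnormN; by have [] := wP n.
move: lb; rewrite /= subrr G0 subr0; have := rnorm_ge0 y; lra.
Qed.

End ClosedGraph.

(** * The Hahn-Banach theorem for complex functionals *)

Section HahnBanach.
Context {R : realType} {X : normedModType R[i]}.
Variables (c : R) (c_ge0 : 0 <= c).

(** Graphs of real-linear functionals dominated by a multiple of the norm.
    The domination at 0 makes such a relation single-valued. *)
Definition dominated_graph (G : set (X * R)) : Prop :=
  [/\ G (0, 0),
      forall (t : R) x r y s, G (x, r) -> G (y, s) ->
        G (t%:C *: x + y, t * r + s) &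
      forall x r, G (x, r) -> r <= c * rnorm x].

Lemma dominated_graph_fun G x r s :
  dominated_graph G -> G (x, r) -> G (x, s) -> r = s.
Proof.
move=> [_ lin dom] Gr Gs.
have le a b : G (x, a) -> G (x, b) -> a <= b.
  move=> Ga Gb; have := dom _ _ (lin (-1) _ _ _ _ Gb Ga).
  by rewrite rmorphN1 scaleN1r addNr rnorm0 mulr0 mulN1r addrC subr_le0.
by apply/le_anti; rewrite !le.
Qed.

Lemma dominated_graphZ G (t : R) x r :
  dominated_graph G -> G (x, r) -> G (t%:C *: x, t * r).
Proof. by move=> [G00 lin _] Gx; have := lin t _ _ _ _ Gx G00; rewrite !addr0. Qed.

Lemma dominated_graphD G x r y s :
  dominated_graph G -> G (x, r) -> G (y, s) -> G (x + y, r + s).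
Proof.
by move=> [_ lin _] Gx Gy; have := lin 1 _ _ _ _ Gx Gy; rewrite rmorph1 scale1r mul1r.
Qed.

(** The value a at the new vector has to separate the numbers
    r - c |y - x0| from the numbers c |z + x0| - s. *)
Lemma dominated_graph_extend G x0 : dominated_graph G ->
  exists G', [/\ dominated_graph G', G `<=` G' & exists a, G' (x0, a)].
Proof.
move=> dG; have [G00 lin dom] := dG.
pose L := [set a | exists y r, G (y, r) /\ a = r - c * rnorm (y - x0)].
have sep y r z s : G (y, r) -> G (z, s) ->
    r - c * rnorm (y - x0) <= c * rnorm (z + x0) - s.
  move=> Gy Gz; have := dom _ _ (dominated_graphD dG Gy Gz).
  have : c * rnorm (y + z) <= c * (rnorm (y - x0) + rnorm (z + x0)).
    rewrite ler_wpM2l// (le_trans _ (rnormD _ _))//.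
    by rewrite (addrC z) addrA subrK.
  rewrite mulrDr; lra.
have L0 : L !=set0 by exists (0 - c * rnorm (0 - x0)), 0, 0.
have supL : has_sup L.
  split => //; exists (c * rnorm (0 + x0) - 0) => _ [y [r [Gy ->]]].
  exact: sep.
pose a := sup L.
have aL y r : G (y, r) -> r - c * rnorm (y - x0) <= a.
  by move=> Gy; apply: ub_le_sup; [exact: supL.2 | exists y, r].
have aU z s : G (z, s) -> a <= c * rnorm (z + x0) - s.
  by move=> Gz; apply: ge_sup => // _ [y [r [Gy ->]]]; exact: sep.
exists [set xr | exists y r t, [/\ G (y, r), xr.1 = y + t%:C *: x0 &
                                xr.2 = r + t * a]]; split.
- split.
  + by exists 0, 0, 0; split; rewrite ?scale0r ?mul0r ?addr0.
  + move=> t x r y s [x' [r' [t' [Gx /= -> ->]]]] [y' [s' [u' [Gy /= -> ->]]]].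
    exists (t%:C *: x' + y'), (t * r' + s'), (t * t' + u'); split => //=.
    * exact: lin.
    * by rewrite scalerDr scalerA rmorphD rmorphM scalerDl addrACA.
    * by ring.
  + move=> x r [y [s [t [Gy /= -> ->]]]].
    have [t0|t0|->] := ltgtP t 0; last first.
    * by rewrite scale0r mul0r !addr0; exact: dom.
    * have := aU _ _ (dominated_graphZ t^-1 dG Gy).
      rewrite -(ler_pM2l t0) mulrBr (mulrA t t^-1) divff ?gt_eqF// mul1r (mulrCA t c).
      have -> : t * rnorm ((t^-1)%:C *: y + x0) = rnorm (y + t%:C *: x0).
        rewrite -[X in X * _](gtr0_norm t0) -rnormZr scalerDr scalerA -rmorphM.
        by rewrite divff ?gt_eqF// scale1r.
      lra.
    * have nt0 : 0 < - t by rewrite oppr_gt0.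
      have := aL _ _ (dominated_graphZ (- t)^-1 dG Gy).
      rewrite -(ler_pM2l nt0) mulrBr (mulrA (- t) (- t)^-1) divff ?gt_eqF// mul1r.
      rewrite (mulrCA (- t) c).
      have -> : - t * rnorm ((- t)^-1%:C *: y - x0) = rnorm (y + t%:C *: x0).
        rewrite -[X in X * _](gtr0_norm nt0) -rnormZr scalerBr scalerA -rmorphM.
        by rewrite divff ?gt_eqF// scale1r rmorphN scaleNr opprK.
      lra.
- by move=> [y r] Gy; exists y, r, 0; split; rewrite ?scale0r ?mul0r ?addr0.
- by exists a, 0, 0, 1; rewrite rmorph1 scale1r mul1r !add0r.
Qed.

(** Zorn's lemma is applied to the sets A whose union with G is a dominated
    graph, so that the empty chain has G itself as a bound. *)
Lemma dominated_graph_total G : dominated_graph G ->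
  exists G', [/\ dominated_graph G', G `<=` G' & forall x, exists r, G' (x, r)].
Proof.
move=> dG.
pose P A := dominated_graph (G `|` A).
have [F FP Ftot|A [PA maxA]] := @Zorn_bigcup (X * R)%type P.
  have in2 u v : (G `|` \bigcup_(A in F) A) u -> (G `|` \bigcup_(A in F) A) v ->
      exists A, [/\ dominated_graph A, A u, A v &
        A `<=` G `|` \bigcup_(A in F) A].
    have sub A : F A -> G `|` A `<=` G `|` \bigcup_(A in F) A.
      by move=> FA z [Gz|Az]; [left|right; exists A].
    move=> [Gu|[A FA Au]] [Gv|[B FB Bv]].
    - by exists G; split => //.
    - by exists (G `|` B); split; [exact: FP|left|right|exact: sub].
    - by exists (G `|` A); split; [exact: FP|right|left|exact: sub].
    - have [AB|BA] := Ftot _ _ FA FB.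
      + by exists (G `|` B); split; [exact: FP|right; exact: AB|right|exact: sub].
      + by exists (G `|` A); split; [exact: FP|right|right; exact: BA|exact: sub].
  have [G00 _ _] := dG.
  split; first by left.
  - move=> t x r y s /in2 h /h[A [[_ lin _] Au Av]]; apply.
    exact: lin.
  - by move=> x r xr; have [A [[_ _ dom] Au _ _]] := in2 _ _ xr xr; exact: dom.
exists (G `|` A); split => //.
move=> x; have [G' [dG' GG' [a G'a]]] := dominated_graph_extend x PA.
exists a; apply: contrapT => nGA.
have UE : G `|` G' = G'.
  by rewrite setUidr// => z Gz; apply: GG'; left.
apply: (maxA G'); last by rewrite /P UE.
split; first by move=> z Az; apply: GG'; right.
by move=> G'A; apply: nGA; right; exact: G'A.
Qed.

(** A complex functional is recovered from its real part u as u x - i u (i x).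
    Estimating the two parts separately costs a factor 2 in the bound, which is
    harmless because only finitely many extensions will be composed. *)
Lemma hahn_banach (E : set X) (f : X -> R[i]) :
  E 0 -> (forall (a : R[i]) x y, E x -> E y -> E (a *: x + y)) ->
  (forall (a : R[i]) x y, E x -> E y -> f (a *: x + y) = a * f x + f y) ->
  (forall x, E x -> rnorm (f x) <= c * rnorm x) ->
  exists g : X -> R[i], [/\
    forall (a : R[i]) x y, g (a *: x + y) = a * g x + g y,
    forall x, rnorm (g x) <= 2 * c * rnorm x & forall x, E x -> g x = f x].
Proof.
move=> E0 EL fL fle.
have f0 : f 0 = 0.
  have := fL 1 _ _ E0 E0; rewrite scale1r addr0 mul1r => /esym/eqP.
  by rewrite -subr_eq0 addrK => /eqP.
pose G := [set xr : X * R | E xr.1 /\ xr.2 = complex.Re (f xr.1)].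
have ReM (t : R) (z : R[i]) : complex.Re (t%:C * z) = t * complex.Re z.
  by case: z => a b /=; rewrite mul0r subr0.
have dG : dominated_graph G.
  split; first by split; rewrite //= f0.
  - move=> t x r y s [/= Ex ->] [/= Ey ->]; split; first exact: EL.
    by rewrite /= fL// raddfD /= ReM.
  - move=> x r [/= Ex ->]; apply: le_trans (fle x Ex).
    exact: le_trans (ler_norm _) (Re_le_rnorm _).
have [G' [dG' GG' tot]] := dominated_graph_total dG.
have [u uP] := choice tot.
have [_ lin dom] := dG'.
have uL (t : R) x y : u (t%:C *: x + y) = t * u x + u y.
  exact: dominated_graph_fun dG' (uP _) (lin _ _ _ _ _ (uP x) (uP y)).
have u0 : u 0 = 0 by apply: (dominated_graph_fun dG' (uP 0)); have [] := dG'.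
have uD x y : u (x + y) = u x + u y.
  by have := uL 1 x y; rewrite rmorph1 scale1r mul1r.
have uZ (t : R) x : u (t%:C *: x) = t * u x.
  by have := uL t x 0; rewrite !addr0 u0 addr0.
have uN x : u (- x) = - u x.
  by have := uZ (-1) x; rewrite rmorphN1 scaleN1r mulN1r.
have ule x : `|u x| <= c * rnorm x.
  by rewrite ler_norml lerNl -uN -{1}(rnormN x) !dom.
have uE x : E x -> u x = complex.Re (f x).
  by move=> Ex; apply: dominated_graph_fun dG' (uP x) (GG' _ _).
pose g x := u x +i* - u ('i *: x).
have gE x : g x = u x +i* - u ('i *: x) by [].
exists g; split.
- move=> [a b] x y.
  have split_ab z : (a +i* b) *: z = a%:C *: z + b%:C *: ('i *: z).
    by rewrite scalerA -scalerDl; congr (_ *: _); apply/eqP;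
       rewrite eq_complex /=; apply/andP; split; apply/eqP; ring.
  have ii z : 'i *: ('i *: z) = - z :> X.
    by rewrite scalerA -expr2 sqr_i scaleN1r.
  rewrite !gE scalerDr scalerA (mulrC 'i) -scalerA !split_ab !uD !uZ ii uN.
  apply/eqP; rewrite eq_complex /=; apply/andP; split; apply/eqP; ring.
- move=> x; rewrite (le_trans (rnorm_le_ReIm _))//= normrN.
  have : rnorm ('i *: x) = rnorm x.
    rewrite rnormZ (_ : rnorm 'i = 1) ?mul1r//.
    by rewrite /rnorm normc_def /= expr0n expr1n add0r sqrtr1.
  have := ule x; have := ule ('i *: x) => + + iE; rewrite iE; lra.
- move=> x Ex; have Eix : E ('i *: x) by rewrite -[_ *: x]addr0; exact: EL.
  have fi : f ('i *: x) = 'i * f x.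
    by rewrite -[_ *: x]addr0 fL// f0 addr0.
  rewrite gE !uE// fi; case: (f x) => a b; apply/eqP.
  by rewrite eq_complex /=; apply/andP; split; apply/eqP; ring.
Qed.

End HahnBanach.

(** * Bounded operators and extension of finite-rank operators *)

Section BoundedOperators.
Context {R : realType} {X : completeNormedModType R[i]}.

Record bop := Bop {
  bop_fun :> X -> X;
  bop_linear : linear bop_fun;
  bop_bounded : exists2 C : R, 0 <= C &
    forall x, rnorm (bop_fun x) <= C * rnorm x }.

HB.instance Definition _ (S : bop) :=
  GRing.isLinear.Build R[i] X X *:%R (bop_fun S) (@bop_linear S).

Program Definition bzero : bop := @Bop (fun=> 0) _ _.
Next Obligation. by move=> a x y; rewrite scaler0 addr0. Qed.
Next Obligation. by exists 0 => // x; rewrite rnorm0 mul0r. Qed.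

Program Definition bid : bop := @Bop (fun x => x) _ _.
Next Obligation. by []. Qed.
Next Obligation. by exists 1 => // x; rewrite mul1r. Qed.

Program Definition badd (S T : bop) : bop := @Bop (fun x => S x + T x) _ _.
Next Obligation. by move=> S T a x y; rewrite !linearP scalerDr addrACA. Qed.
Next Obligation.
move=> S T; have [C C0 SC] := bop_bounded S; have [D D0 TD] := bop_bounded T.
exists (C + D); first exact: addr_ge0.
by move=> x; rewrite mulrDl (le_trans (rnormD _ _))// lerD.
Qed.

Program Definition bopp (S : bop) : bop := @Bop (fun x => - S x) _ _.
Next Obligation. by move=> S a x y; rewrite linearP opprD scalerN. Qed.
Next Obligation.
move=> S; have [C C0 SC] := bop_bounded S; exists C => // x.
by rewrite rnormN.
Qed.

Program Definition bscale (a : R[i]) (S : bop) : bop :=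
  @Bop (fun x => a *: S x) _ _.
Next Obligation.
by move=> a S b x y; rewrite linearP scalerDr !scalerA (mulrC a).
Qed.
Next Obligation.
move=> a S; have [C C0 SC] := bop_bounded S.
exists (rnorm a * C); first by rewrite mulr_ge0 ?rnorm_ge0.
by move=> x; rewrite rnormZ -mulrA ler_wpM2l ?rnorm_ge0.
Qed.

Program Definition bcomp (S T : bop) : bop := @Bop (fun x => S (T x)) _ _.
Next Obligation. by move=> S T a x y; rewrite !linearP. Qed.
Next Obligation.
move=> S T; have [C C0 SC] := bop_bounded S; have [D D0 TD] := bop_bounded T.
exists (C * D); first exact: mulr_ge0.
by move=> x; rewrite (le_trans (SC _))// -mulrA ler_wpM2l.
Qed.

Definition bpow (S : bop) (k : nat) : bop := iter k (bcomp S) bid.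

Lemma bpowE S k x : bpow S k x = iter k S x.
Proof. by elim: k => //= k ->. Qed.

Definition bsum (n : nat) (S : nat -> bop) : bop :=
  \big[badd/bzero]_(i < n) S i.

Lemma bsumE n S x : bsum n S x = \sum_(i < n) S i x.
Proof. by rewrite /bsum (big_morph (fun T : bop => T x) (id1 := 0) (op1 := +%R)). Qed.

Definition bcommute (S T : bop) : Prop := forall x, S (T x) = T (S x).

Lemma bcommute_iter (S T : bop) k x :
  bcommute S T -> S (iter k T x) = iter k T (S x).
Proof. by move=> ST; elim: k => //= k IH; rewrite ST IH. Qed.

Definition bounded_functional (g : X -> R[i]) : Prop :=
  (forall (a : R[i]) x y, g (a *: x + y) = a * g x + g y) /\
  exists2 C : R, 0 <= C & forall x, rnorm (g x) <= C * rnorm x.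

(** The operators g(x) w; all finite-rank operators are sums of these. *)
Lemma functional_rank1 (g : X -> R[i]) (w : X) : bounded_functional g ->
  exists T : bop, forall x, T x = g x *: w.
Proof.
move=> [gL [C C0 gC]]; unshelve eexists (@Bop (fun x => g x *: w) _ _) => //.
- by move=> a x y; rewrite gL scalerDl scalerA.
- exists (C * rnorm w); first by rewrite mulr_ge0 ?rnorm_ge0.
  by move=> x; rewrite rnormZ mulrAC ler_wpM2r ?rnorm_ge0.
Qed.

Lemma functional_comp (g : X -> R[i]) (S : bop) : bounded_functional g ->
  bounded_functional (fun x => g (S x)).
Proof.
move=> [gL [C C0 gC]]; have [D D0 SD] := bop_bounded S; split.
  by move=> a x y; rewrite linearP gL.
exists (C * D); first exact: mulr_ge0.
by move=> x; rewrite (le_trans (gC _))// -mulrA ler_wpM2l.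
Qed.

Lemma functional0 (g : X -> R[i]) : bounded_functional g -> g 0 = 0.
Proof.
move=> [gL _]; have := gL 1 0 0; rewrite scale1r addr0 mul1r => /esym/eqP.
by rewrite -subr_eq0 addrK => /eqP.
Qed.

End BoundedOperators.
Arguments bop {R} X.
Arguments bid {R X}.
Arguments bzero {R X}.

Section FiniteRank.
Context {R : realType} {X : completeNormedModType R[i]}.

Definition span n (v : 'I_n -> X) : set X :=
  [set x | exists c : 'I_n -> R[i], x = \sum_(i < n) c i *: v i].

Lemma span_subspace n (v : 'I_n -> X) : linear_subspace (span v).
Proof.
split.
  by rewrite inE; exists (fun=> 0); rewrite big1// => i _; rewrite scale0r.
move=> a x y; rewrite !inE => -[c ->] [d ->].
exists (fun i => a * c i + d i); rewrite scaler_sumr -big_split /=.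
by apply: eq_bigr => i _; rewrite scalerDl scalerA.
Qed.

Lemma span_gen n (v : 'I_n -> X) i : span v (v i).
Proof.
exists (fun j => (j == i)%:R); rewrite (bigD1 i)//= eqxx scale1r big1 ?addr0//.
by move=> j /negbTE ->; rewrite scale0r.
Qed.

Lemma subspace_sum (A : set X) n (v : 'I_n -> X) :
  linear_subspace A -> (forall i, A (v i)) -> A (\sum_(i < n) v i).
Proof.
move=> linA Av; apply: (big_ind A) => //; first exact: subspace0.
by move=> x y; exact: subspaceD.
Qed.

Lemma span_sub (A : set X) n (v : 'I_n -> X) :
  linear_subspace A -> (forall i, A (v i)) -> span v `<=` A.
Proof.
move=> linA Av x [c ->]; apply: subspace_sum => // i.
exact: subspaceZ.
Qed.

(** Stating the conclusion as g(w) w = w covers w = 0 as well. *)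
Lemma exists_functional (w : X) :
  exists2 g : X -> R[i], bounded_functional g & g w *: w = w.
Proof.
have [->|w0] := eqVneq w 0.
  exists (fun=> 0); last by rewrite scaler0.
  split; first by move=> a x y; rewrite mulr0 addr0.
  by exists 0 => // x; rewrite rnorm0 mul0r.
have nw : 0 < rnorm w.
  rewrite lt_def rnorm_ge0 andbT; apply: contra w0 => /eqP/rnorm0_eq0 ->//.
pose E := [set x | exists a : R[i], x = a *: w].
have /choice[f fP] : forall x, exists a : R[i], E x -> x = a *: w.
  move=> x.
  by have [[a xa]|nE] := pselect (E x); [exists a|exists 0].
have wI a b : a *: w = b *: w -> a = b.
  move=> /eqP; rewrite -subr_eq0 -scalerBl scaler_eq0 (negbTE w0) orbF.
  by rewrite subr_eq0 => /eqP.
have EL (a : R[i]) x y : E x -> E y -> E (a *: x + y).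
  by move=> [b ->] [d ->]; exists (a * b + d); rewrite scalerDl scalerA.
have E0 : E 0 by exists 0; rewrite scale0r.
have [||//|g [gL gC gf]] := @hahn_banach _ _ (rnorm w)^-1 _ E f E0 EL.
- by rewrite invr_ge0 ltW.
- move=> a x y Ex Ey; apply: wI; rewrite -fP; last exact: EL.
  by rewrite {1}(fP _ Ex) {1}(fP _ Ey) scalerDl scalerA.
- by move=> x /fP xE; rewrite {2}xE rnormZ mulrCA mulVf ?gt_eqF// mulr1.
have Ew : E w by exists 1; rewrite scale1r.
exists g; last by rewrite gf// -fP.
split => //; exists (2 * (rnorm w)^-1) => //.
by rewrite mulr_ge0// invr_ge0 ltW.
Qed.

(** The sum of the g_j(x) w_j is a bounded projection onto the span of the v_i.
    Each new vector is first corrected by the part of it that the previous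
    functionals already reproduce; a correction equal to 0 signals a linear
    dependence and adds nothing. *)
Lemma span_functionals n (v : nat -> X) :
  exists (g : nat -> X -> R[i]) (w : nat -> X),
  [/\ forall i, bounded_functional (g i),
      forall i : 'I_n, span (fun j : 'I_n => v j) (w i) &
      forall i : 'I_n, v i = \sum_(j < n) g j (v i) *: w j].
Proof.
elim: n => [|n [g [w [gB ws vE]]]].
  exists (fun _ _ => 0), (fun=> 0); split; [|by case|by case].
  move=> _; split; first by move=> a x y; rewrite mulr0 addr0.
  by exists 0 => // x; rewrite rnorm0 mul0r.
have /choice[T TE] : forall i, exists T : bop X, forall x, T x = g i x *: w i.
  by move=> i; exact: functional_rank1.
pose P := bsum n T.
have PE x : P x = \sum_(j < n) g j x *: w j.
  by rewrite bsumE; apply: eq_bigr => j _; rewrite TE.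
have [h hB hE] := exists_functional (v n - P (v n)).
exists (fun i => if (i < n)%N then g i else fun x => h (badd bid (bopp P) x)).
exists (fun i => if (i < n)%N then w i else v n - P (v n)).
have sub : span (fun j : 'I_n => v j) `<=` span (fun j : 'I_n.+1 => v j).
  apply: span_sub; first exact: span_subspace.
  by move=> i; exact: (span_gen (fun j : 'I_n.+1 => v j) (widen_ord (leqnSn n) i)).
split.
- by move=> i; case: ifP => // _; exact: functional_comp.
- move=> i; case: ifP => ni; first by apply: sub; exact: (ws (Ordinal ni)).
  have spS := span_subspace (fun j : 'I_n.+1 => v j).
  apply: (subspaceB spS); first exact: (span_gen _ (@ord_max n)).
  rewrite PE; apply: subspace_sum => // j; apply: (subspaceZ spS).
  by apply: sub; exact: ws.
- move=> i; rewrite big_ord_recr /= ltnn.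
  under eq_bigr do rewrite ltn_ord.
  rewrite -PE; have [ni|ni] := ltnP i n.
    have Pv : P (v i) = v i by rewrite PE [RHS](vE (Ordinal ni)).
    by rewrite Pv subrr functional0// scale0r addr0.
  have -> : (i : nat) = n by apply/eqP; rewrite eqn_leq ni -ltnS ltn_ord.
  by rewrite hE addrC subrK.
Qed.

(** D is a finite sum of terms g(x) w.  Each g, carried from M to B(M) by the
    inverse of B, remains bounded because B is bounded below, hence extends to
    the whole space by Hahn-Banach. *)
Lemma finite_rank_extension (B D : bop X) (M : set X) (K : R)
    n (v : nat -> X) :
  linear_subspace M -> 0 <= K ->
  (forall x, M x -> rnorm x <= K * rnorm (B x)) ->
  (forall x, span (fun i : 'I_n => v i) (D x)) ->
  exists2 D' : bop X, (forall x, M x -> D' (B x) = D x) &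
    forall x, span (fun i : 'I_n => v i) (D' x).
Proof.
move=> linM K0 BK Dv; have [g [w [gB ws vE]]] := span_functionals n v.
have DE x : D x = \sum_(j < n) g j (D x) *: w j.
  have [c ->] := Dv x.
  have gsum j (u : 'I_n -> R[i]) : g j (\sum_(i < n) u i *: v i) = \sum_(i < n) u i * g j (v i).
    have [gL _] := gB j.
    apply: (big_ind2 (fun y r => g j y = r)); first exact: functional0.
      by move=> y r z s <- <-; have := gL 1 y z; rewrite scale1r mul1r.
    by move=> i _; have := gL (u i) (v i) 0; rewrite functional0// !addr0.
  under [RHS]eq_bigr do rewrite gsum scaler_suml.
  rewrite exchange_big /=; apply: eq_bigr => i _.
  rewrite {1}vE scaler_sumr; apply: eq_bigr => j _; by rewrite scalerA.
have BI x y : M x -> M y -> B x = B y -> x = y.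
  move=> Mx My Bxy; apply/subr0_eq/rnorm0_eq0/le_anti.
  rewrite rnorm_ge0 andbT (le_trans (BK _ _))//; first exact: (subspaceB linM).
  by rewrite raddfB /= Bxy subrr rnorm0 mulr0.
have [f fP] : exists f : X -> X, forall x, M x -> f (B x) = x.
  have : forall y, exists x, forall x', M x' -> B x' = y -> x = x'.
    move=> y; have [[x [Mx xy]]|nx] := pselect (exists x, M x /\ B x = y).
      by exists x => x' Mx' x'y; apply: BI => //; rewrite xy.
    by exists 0 => x' Mx' x'y; case: nx; exists x'.
  by move=> /choice[f fP]; exists f => x Mx; exact: fP.
have /choice[T TP] : forall j, exists T : bop X,
    (forall x, M x -> T (B x) = g j (D x) *: w j) /\
    forall x, exists a, T x = a *: w j.
  move=> j; have [gL [C C0 gC]] := functional_comp D (gB j).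
  have [|||||h [hL hC hE]] := @hahn_banach _ _ (C * K) _ (B @` M) (fun y => g j (D (f y))).
  - exact: mulr_ge0.
  - by exists 0; [exact: subspace0|rewrite raddf0].
  - move=> a _ _ [x Mx <-] [y My <-]; exists (a *: x + y); last by rewrite linearP.
    exact: (subspace_comb linM).
  - move=> a _ _ [x Mx <-] [y My <-]; rewrite -linearP !fP ?gL//.
    exact: (subspace_comb linM).
  - move=> _ [x Mx <-]; rewrite fP// (le_trans (gC _))// -mulrA ler_wpM2l//.
    exact: BK.
  have [|T TE] := @functional_rank1 _ _ h (w j).
    split => //; exists (2 * (C * K)) => //.
    by rewrite !mulr_ge0.
  exists T; split => [x Mx|x]; last by exists (h x).
  by rewrite TE hE ?fP//; exists x.
exists (bsum n T).
  move=> x Mx; rewrite bsumE [RHS]DE; apply: eq_bigr => j _.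
  by have [-> //] := TP j.
have spv := span_subspace (fun i : 'I_n => v i).
move=> x; rewrite bsumE; apply: subspace_sum => // j.
have [_ /(_ x)[a ->]] := TP j; apply: (subspaceZ spv); exact: ws.
Qed.

End FiniteRank.

(** * Fitting decomposition and the quasinilpotent part *)

Section Fitting.
Context {R : realType} {X : completeNormedModType R[i]}.

Lemma cayley_hamilton_sum n (A : 'M[R[i]]_n.+1) s :
  (size (char_poly A) <= s)%N ->
  \sum_(m < s) (char_poly A)`_m *: A ^+ m = 0.
Proof.
move=> ps; rewrite -[RHS](Cayley_Hamilton A).
have {2}-> : char_poly A = \poly_(m < s) (char_poly A)`_m.
  apply/polyP => i; rewrite coef_poly; case: ltnP => // si.
  by rewrite nth_default// (leq_trans ps).
rewrite poly_def linear_sum /=; apply: eq_bigr => i _.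
by rewrite linearZ /= rmorphXn /= horner_mx_X.
Qed.

Lemma ker_subspace (T : bop X) : linear_subspace [set x | T x = 0].
Proof.
split; first by rewrite inE /= raddf0.
move=> a x y; rewrite !inE => Tx Ty.
by rewrite /mkset linearP /= Tx Ty scaler0 addr0.
Qed.

(** On a finite-dimensional invariant subspace the characteristic polynomial
    annihilates S; dividing by its lowest nonzero coefficient turns this into
    S^k = S^(k+1) U with U a polynomial in S. *)
Lemma fitting (S : bop X) n (v : 'I_n -> X) :
  (forall i, span v (S (v i))) ->
  exists (k : nat) (U : bop X),
    (forall T, bcommute T S -> bcommute T U) /\
    forall x, span v x -> iter k S x = iter k.+1 S (U x).
Proof.
case: n v => [|n] v Sv.
  exists 0%N, bzero; split; first by move=> T _ x; rewrite /= raddf0.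
  by move=> x [c ->]; rewrite big_ord0 /= raddf0.
have /choice[a aE] := Sv.
pose A := \matrix_(i, j) a i j.
have itS m i : iter m S (v i) = \sum_j (A ^+ m) i j *: v j.
  elim: m => [|m IH].
    rewrite expr0 (bigD1 i)//= mxE eqxx scale1r big1 ?addr0// => j ji.
    by rewrite mxE eq_sym (negbTE ji) scale0r.
  rewrite iterS IH linear_sum /=.
  under eq_bigr do rewrite linearZ /= aE scaler_sumr.
  rewrite exchange_big /=; apply: eq_bigr => j _.
  rewrite exprSr mxE scaler_suml; apply: eq_bigr => l _.
  by rewrite scalerA !mxE.
pose p := char_poly A.
(* k is the multiplicity of 0 as a root of the characteristic polynomial *)
have [|k pk kmin] := @ex_minnP (fun m => p`_m != 0).
  exists (size p).-1; rewrite -[_`_ _]/(lead_coef p).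
  by rewrite (monicP (char_poly_monic A)) oner_neq0.
pose s := (k.+1 + size p)%N.
have ann x : span v x -> \sum_(m < s) p`_m *: iter m S x = 0.
  pose Pz := bsum s (fun m => bscale p`_m (bpow S m)).
  have PzE y : Pz y = \sum_(m < s) p`_m *: iter m S y.
    by rewrite bsumE; apply: eq_bigr => m _ /=; rewrite bpowE.
  move=> vx; rewrite -PzE; apply: (span_sub _ _ vx (A := [set y | Pz y = 0])).
    exact: ker_subspace.
  move=> i /=; rewrite PzE; under eq_bigr do rewrite itS scaler_sumr.
  rewrite exchange_big /= big1// => j _.
  under eq_bigr do rewrite scalerA.
  rewrite -scaler_suml; have := cayley_hamilton_sum (leq_addl k.+1 (size (char_poly A))).
  move=> /matrixP/(_ i j); rewrite summxE mxE => h.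
  rewrite (_ : \sum_(_ < s) _ = 0) ?scale0r// -[RHS]h.
  by apply: eq_bigr => m _; rewrite mxE.
exists k, (bsum (size p) (fun i => bscale (- (p`_(k.+1 + i) / p`_k)) (bpow S i))).
split.
  move=> T TS x; rewrite !bsumE linear_sum /=; apply: eq_bigr => i _.
  by rewrite linearZ /= !bpowE bcommute_iter.
move=> x /ann; rewrite big_split_ord /= big_ord_recr /= big1 ?add0r; last first.
  move=> i _; have [->|/kmin] := eqVneq p`_i 0; first by rewrite scale0r.
  by rewrite leqNgt ltn_ord.
move=> /(congr1 (fun y => (p`_k)^-1 *: y)).
rewrite scaler0 scalerDr scalerA mulVf// scale1r => /eqP; rewrite addr_eq0 => /eqP ->.
rewrite bsumE -bpowE (raddf_sum (bpow S k)) (raddf_sum S) /=.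
rewrite scaler_sumr -sumrN; apply: eq_bigr => i _.
rewrite (linearZ_LR (bpow S k)) (linearZ_LR S) /=.
by rewrite !bpowE -iterD scalerA -scaleNr mulrC.
Qed.

(** The projection onto the part of a finite-rank operator where it is
    invertible, along the part where it is nilpotent. *)
Lemma fitting_projection (F : bop X) n (v : 'I_n -> X) :
  (forall x, span v (F x)) ->
  exists (k : nat) (P : bop X),
  [/\ forall T, bcommute T F -> bcommute T P,
      forall x, P (P x) = P x,
      forall x, iter k F (x - P x) = 0,
      exists2 K : R, 0 <= K & forall x, rnorm (P x) <= K * rnorm (F (P x)) &
      forall x, span v (P x)].
Proof.
move=> Fv; have [k [U [UC FU]]] := fitting (fun i => Fv (v i)).
have CU : bcommute F U by apply: UC.
(* one more power makes the relation valid on the whole space *)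
have {}FU x : iter k.+1 F x = iter k.+2 F (U x).
  by rewrite iterSr FU// -CU -iterSr.
have FUj j x : iter k.+1 F x = iter (k.+1 + j) F (iter j U x).
  elim: j x => [|j IH] x; first by rewrite addn0.
  have -> : (k.+1 + j.+1 = j + k.+2)%N by rewrite addnC addSnnS.
  by rewrite iterD [iter j.+1 U x]iterS -FU -iterD addnC -IH.
pose P := bcomp (bpow F k.+1) (bpow U k.+1).
have PE x : P x = iter k.+1 F (iter k.+1 U x) by rewrite /P /= !bpowE.
have comF T : bcommute T F -> bcommute T P.
  move=> TF x; rewrite !PE bcommute_iter// bcommute_iter//.
  exact: UC.
have itP x : iter k.+1 F (P x) = iter k.+1 F x.
  by rewrite PE -iterD -FUj.
have PP x : P (P x) = P x.
  have cU : bcommute P U by apply: UC => y; rewrite comF.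
  by rewrite [LHS]PE -(bcommute_iter k.+1 x cU) itP -PE.
exists k.+1, P; split => //.
- move=> x; rewrite -bpowE raddfB.
  by rewrite -[LHS]/(bpow F k.+1 x - bpow F k.+1 (P x)) !bpowE itP subrr.
- pose V := bcomp (bpow F k) (bpow U k.+1).
  have [K K0 VK] := bop_bounded V; exists K => // x.
  suff {1}<- : V (F (P x)) = P x by exact: VK.
  have cF' : bcommute F (bpow U k.+1) by move=> y; rewrite !bpowE bcommute_iter.
  by rewrite -[LHS]/(bpow F k (bpow U k.+1 (F (P x)))) -cF' !bpowE -iterSr -PE PP.
- by move=> x; rewrite PE iterS.
Qed.

End Fitting.

Section QuasinilpotentPart.
Context {R : realType} {X : completeNormedModType R[i]}.
Implicit Types S T N : bop X.

(** The condition |S^n x|^(1/n) -> 0 without roots; unlike the limit, it is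
    visibly stable under sums and commuting operators. *)
Definition superexp_decay (S : X -> X) (x : X) : Prop :=
  forall e : R, 0 < e -> exists2 K : R, 0 <= K &
    forall n, rnorm (iter n S x) <= K * e ^+ n.

Lemma quasinilpotent_partP (S : X -> X) x :
  quasinilpotent_part S x <-> superexp_decay S x.
Proof.
split.
  move=> /cvgrPdist_le Sx e e0.
  have [|N _ SN] := Sx e%:C; first by rewrite ltcR.
  exists (1 + \sum_(n < N.+1) rnorm (iter n S x) / e ^+ n).
    by rewrite addr_ge0// sumr_ge0// => n _; rewrite divr_ge0 ?rnorm_ge0 ?exprn_ge0 ?ltW.
  move=> n; rewrite mulrDl mul1r; have en0 : 0 < e ^+ n by rewrite exprn_gt0.
  have sum0 (m : nat) : 0 <= rnorm (iter m S x) / e ^+ m.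
    by rewrite divr_ge0 ?rnorm_ge0 ?exprn_ge0 ?ltW.
  have [nN|Nn] := ltnP n N.+1.
    rewrite (bigD1 (Ordinal nN))//= mulrDl divfK ?gt_eqF//.
    rewrite addrCA lerDl addr_ge0 ?(ltW en0)//.
    by rewrite mulr_ge0 ?(ltW en0)// sumr_ge0.
  case: n en0 Nn => [//|n] en0 Nn; have := SN _ (ltnW Nn).
  rewrite /= sub0r normrN ger0_norm ?rootC_ge0// => h.
  have : (n.+1.-root `|iter n.+1 S x|) ^+ n.+1 <= e%:C ^+ n.+1.
    by rewrite lerXn2r// nnegrE ?rootC_ge0// ler0c ltW.
  rewrite rootCK// rnormE -rmorphXn lecR => h'; rewrite (le_trans h')// lerDl.
  by rewrite mulr_ge0 ?(ltW en0)// sumr_ge0.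
move=> Sx; apply/cvgrPdist_le => e e0.
have eE : e = (complex.Re e)%:C by rewrite RRe_real// realE ltW.
have {}e0 : 0 < complex.Re e by rewrite -ltcR -eE.
have [|K K0 SK] := Sx (complex.Re e / 2); first by rewrite divr_gt0.
(* K (e/2)^n <= e^n as soon as K <= n, because n <= 2^n *)
exists (Num.truncn K).+1 => // n /= Kn.
have n0 : (0 < n)%N by apply: leq_trans Kn.
rewrite sub0r normrN ger0_norm ?rootC_ge0// eE.
rewrite -(@ler_pXn2r _ n)// ?nnegrE ?rootC_ge0// ?ler0c ?(ltW e0)//.
rewrite rootCK// rnormE -rmorphXn lecR (le_trans (SK n))//.
rewrite expr_div_n mulrCA ger_pMr ?exprn_gt0// ler_pdivrMr ?exprn_gt0// mul1r.
rewrite (le_trans (ltW (truncnS_gt K)))// -natrX ler_nat (leq_trans Kn)//.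
by rewrite ltnW// ltn_expl.
Qed.

Lemma superexp_decay_comb S (a : R[i]) x y :
  superexp_decay S x -> superexp_decay S y -> superexp_decay S (a *: x + y).
Proof.
move=> Sx Sy e e0; have [K K0 xK] := Sx e e0; have [L L0 yL] := Sy e e0.
exists (rnorm a * K + L); first by rewrite addr_ge0// mulr_ge0 ?rnorm_ge0.
move=> n; rewrite -bpowE linearP -[X in rnorm X]/(a *: bpow S n x + bpow S n y).
rewrite !bpowE (le_trans (rnormD _ _))// mulrDl rnormZ.
by rewrite lerD// -mulrA ler_wpM2l ?rnorm_ge0.
Qed.

Lemma quasinilpotent_part_subspace S : linear_subspace (quasinilpotent_part S).
Proof.
split.
  rewrite inE; apply/quasinilpotent_partP => e e0; exists 0 => // n.
  by rewrite -bpowE raddf0 rnorm0 mul0r.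
move=> a x y; rewrite !inE => /quasinilpotent_partP Sx /quasinilpotent_partP Sy.
exact/quasinilpotent_partP/superexp_decay_comb.
Qed.

Lemma quasinilpotent_part_commute S T x :
  bcommute T S -> quasinilpotent_part S x -> quasinilpotent_part S (T x).
Proof.
move=> TS /quasinilpotent_partP Sx; apply/quasinilpotent_partP => e /Sx[K K0 xK].
have [C C0 TC] := bop_bounded T; exists (C * K); first exact: mulr_ge0.
move=> n; rewrite -bcommute_iter// (le_trans (TC _))// -mulrA ler_wpM2l//.
Qed.

Lemma quasinilpotent_part_nilpotent S k x :
  iter k S x = 0 -> quasinilpotent_part S x.
Proof.
move=> Sk; apply/quasinilpotent_partP => e e0.
exists (\sum_(n < k) rnorm (iter n S x) / e ^+ n).
  by rewrite sumr_ge0// => n _; rewrite divr_ge0 ?rnorm_ge0 ?exprn_ge0 ?ltW.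
move=> n; have en0 : 0 < e ^+ n by rewrite exprn_gt0.
have sum0 (m : nat) : 0 <= rnorm (iter m S x) / e ^+ m.
  by rewrite divr_ge0 ?rnorm_ge0 ?exprn_ge0 ?ltW.
have [nk|/subnK <-] := ltnP n k.
  rewrite (bigD1 (Ordinal nk))//= mulrDl divfK ?gt_eqF// lerDl.
  by rewrite mulr_ge0 ?(ltW en0)// sumr_ge0.
rewrite iterD Sk -bpowE raddf0 rnorm0 mulr_ge0 ?sumr_ge0// exprn_ge0// ltW//.
Qed.

(** Vectors of the quasinilpotent part decay faster than any exponential. *)
Lemma quasinilpotent_part_eq0 S (K : R) x : 0 <= K ->
  (forall n, rnorm x <= K ^+ n * rnorm (iter n S x)) ->
  quasinilpotent_part S x -> x = 0.
Proof.
move=> K0 xK /quasinilpotent_partP Sx.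
have K1 : 0 < K + 1 by rewrite ltr_wpDl.
have [|L L0 xL] := Sx ((2 * (K + 1))^-1); first by rewrite invr_gt0 mulr_gt0.
apply: (rnorm_small0 (c := L)) => e e0.
have /cvgrPdist_le/(_ e e0)[n _ /(_ n (leqnn n))] : geometric 1 (2^-1 : R) @ \oo --> (0 : R).
  by apply: cvg_geometric; rewrite ger0_norm ?invr_ge0// invf_lt1// ltr1n.
rewrite /= sub0r normrN mul1r => /(le_trans (ler_norm _)) hn.
apply: (le_trans (xK n)); rewrite (@le_trans _ _ ((K + 1) ^+ n * (L * (2 * (K + 1))^-1 ^+ n)))//.
  apply: ler_pM => //; [exact: exprn_ge0|exact: rnorm_ge0|].
  by rewrite lerXn2r ?nnegrE ?lerDl// ltW.
rewrite mulrCA -exprMn invfM mulrCA divff ?gt_eqF// mulr1.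
by rewrite ler_wpM2l.
Qed.

(** (S + N)^(n+1) S^m x = (S + N)^n S^(m+1) x + (S + N)^n S^m (N x): the last
    term is controlled by induction on the nilpotency order of N at x. *)
Lemma quasinilpotent_part_perturb S N k x : bcommute N S ->
  iter k N x = 0 -> quasinilpotent_part S x ->
  quasinilpotent_part (badd S N) x.
Proof.
move=> NS Nk /quasinilpotent_partP Sx; apply/quasinilpotent_partP.
suff mixed : forall e : R, 0 < e -> exists2 K : R, 0 <= K & forall n m,
    rnorm (iter n (badd S N) (iter m S x)) <= K * e ^+ (n + m).
  by move=> e /mixed[K K0 xK]; exists K => // n; have := xK n 0%N; rewrite addn0.
elim: k x Nk Sx => [|k IH] x Nk Sx e e0.
  exists 0 => // n m; rewrite mul0r.
  by rewrite [x]Nk -!bpowE !raddf0 rnorm0.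
have e2 : 0 < e / 2 by rewrite divr_gt0.
have [K K0 xK] := Sx _ e2.
have [||L L0 xL] := IH (N x) _ _ _ e2; first by rewrite -iterSr.
  by apply/quasinilpotent_partP/quasinilpotent_part_commute => //; apply/quasinilpotent_partP.
have bound n m : rnorm (iter n (badd S N) (iter m S x)) <=
    (K + n%:R * (L / (e / 2))) * (e / 2) ^+ (n + m).
  elim: n m => [|n IHn] m; first by rewrite mul0r addr0; exact: xK.
  rewrite iterSr -[badd _ _ _]/(S (iter m S x) + N (iter m S x)) -iterS.
  rewrite bcommute_iter// -bpowE raddfD /= !bpowE (le_trans (rnormD _ _))//.
  have := IHn m.+1; have := xL n m; rewrite addnS addSn => h1 h2.
  have -> : (K + n.+1%:R * (L / (e / 2))) * (e / 2) ^+ (n + m).+1 =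
    (K + n%:R * (L / (e / 2))) * (e / 2) ^+ (n + m).+1 + L * (e / 2) ^+ (n + m).
    rewrite -natr1 exprS; field; exact: lt0r_neq0.
  exact: lerD.
have c0 : 0 <= L / (e / 2) by rewrite divr_ge0// ltW.
exists (K + L / (e / 2)); first exact: addr_ge0.
move=> n m; rewrite (le_trans (bound n m))// expr_div_n.
rewrite mulrCA [leRHS]mulrC ler_wpM2l ?exprn_ge0 ?(ltW e0)// ler_pdivrMr ?exprn_gt0//.
rewrite !mulrDl lerD//.
  by rewrite ler_peMr// exprn_ege1// ler1n.
rewrite mulrC ler_wpM2l// -natrX ler_nat (leq_trans _ (ltnW (ltn_expl (n + m) _)))//.
exact: leq_addr.
Qed.

End QuasinilpotentPart.

(** * Perturbation of the projection *)

Section Perturbation.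
Context {R : realType} {X : completeNormedModType R[i]}.
Implicit Types S F P Q E A : bop X.

Definition bounded_below_on S (M : set X) : Prop :=
  exists2 K : R, 0 <= K & forall x, M x -> rnorm x <= K * rnorm (S x).

(** The operator form of left generalized Drazin invertibility: P is the
    projection onto the quasinilpotent part along the invariant complement. *)
Definition lgD_projection S P : Prop :=
  [/\ forall x, P (P x) = P x, bcommute P S,
      forall x, quasinilpotent_part S (P x) &
      bounded_below_on S [set x | P x = 0]].

(** A vector x with A^(k+1) x = 0 satisfies |x| <= K |S x|, where
    S x = (S + A) x - A x, and A x is controlled by (S + A)(A x) = A (S + A) x by
    induction on k. *)
Lemma bounded_below_nilpotent S A (M : set X) k :
  (forall x, M x -> M (A x)) -> bcommute A S -> bounded_below_on S M ->
  bounded_below_on (badd S A) [set x | M x /\ iter k A x = 0].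
Proof.
move=> MA AS [K K0 SK]; elim: k => [|k [L L0 IH]].
  by exists 0 => // x [_ /= ->]; rewrite rnorm0 mul0r.
have [C C0 AC] := bop_bounded A.
exists (K * (1 + L * C)); first by rewrite mulr_ge0 ?addr_ge0 ?mulr_ge0.
move=> x [Mx Akx]; rewrite (le_trans (SK x Mx))// -mulrA ler_wpM2l//.
have {1}-> : S x = badd S A x - A x by rewrite /= addrK.
rewrite (le_trans (rnorm_sub _ _))// mulrDl mul1r lerD2l.
have := IH (A x) (conj (MA x Mx) _); rewrite -iterSr => /(_ Akx) h.
apply: (le_trans h); rewrite -mulrA ler_wpM2l//.
by rewrite /= -AS -raddfD; exact: AC.
Qed.

Lemma iter_add_nilpotent S F p k x : bcommute F S ->
  iter p S x = 0 -> iter k F x = 0 -> iter (p + k) (badd S F) x = 0.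
Proof.
move=> FS; have [n] := ubnP (p + k); elim: n p k x => // n IH p k x.
have iter0 T j : iter j (T : bop X) 0 = 0 by rewrite -bpowE raddf0.
case: p => [|p]; first by move=> _ x0 _; rewrite [x]x0; exact: iter0.
case: k => [|k]; first by move=> _ _ x0; rewrite [x]x0; exact: iter0.
rewrite addSn ltnS => pkn Sp Fk.
rewrite iterSr -bpowE -[badd S F x]/(S x + F x) raddfD.
rewrite -[LHS]/(bpow _ _ (S x) + bpow _ _ (F x)) !bpowE IH ?add0r//.
- by rewrite addnS -addSn IH -?iterSr// ?addSnnS -?bcommute_iter ?Sp ?raddf0//.
- by rewrite -iterSr.
- have SF : bcommute S F by move=> y; rewrite FS.
  by rewrite -bcommute_iter// Fk raddf0.
Qed.

(** With S^k = S^(k+1) U as above, z = S^k x satisfies z = U^n S^n z for every n,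
    so |z| <= C^n |S^n z| with C a bound of U, which tends to 0. *)
Lemma quasinilpotent_span_nilpotent S n (v : 'I_n -> X) :
  (forall i, span v (S (v i))) ->
  span v `<=` quasinilpotent_part S ->
  exists k, forall x, span v x -> iter k S x = 0.
Proof.
move=> Sv vH; have [k [U [UC SU]]] := fitting Sv.
have CS : bcommute U S.
  by move=> x; rewrite UC.
have [C C0 UB] := bop_bounded U.
exists k => x vx; set z := iter k S x.
have zE : z = U (S z).
  by rewrite -iterS bcommute_iter// -SU.
have zn n' : z = iter n' U (iter n' S z).
  elim: n' => // j IH; rewrite iterSr -bcommute_iter; last by [].
  by rewrite [in LHS]IH iterS {1}zE -!bcommute_iter.
have UBn n' y : rnorm (iter n' U y) <= C ^+ n' * rnorm y.
  elim: n' => [|j IH]; first by rewrite expr0 mul1r.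
  by rewrite iterS (le_trans (UB _))// exprS -mulrA ler_wpM2l.
apply: (quasinilpotent_part_eq0 (S := S) C0).
  by move=> n'; rewrite {1}(zn n'); exact: UBn.
rewrite /z -bpowE; apply: quasinilpotent_part_commute; last exact: vH.
by move=> y; rewrite !bpowE -iterSr.
Qed.

(** On the range of E, relative to the decomposition ker Q + ran Q, the
    operator S + F is block triangular.  The invariant complement is restored by
    solving the Sylvester equation Z B = (S + F) Z + Q F on ker Q, where B is the
    compression of S + F: since (S + F)^N vanishes on the range of Q F, the usual
    series Z = D_1 + (S + F) D_2 + (S + F)^2 D_3 + ..., with D_(j+1) B = D_j and
    D_0 = Q F, is a finite sum. *)
Lemma nilpotent_perturbation S F Q E n (v : nat -> X) k :
  bcommute F S ->
  (forall x, span (fun i : 'I_n => v i) (F x)) ->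
  (forall i, exists y, v i = F y) ->
  (forall x, E (E x) = E x) -> bcommute E S -> bcommute E F ->
  (forall x, iter k F (E x) = 0) ->
  (forall x, Q (Q x) = Q x) -> (forall x, Q (E x) = Q x) ->
  (forall x, E (Q x) = Q x) -> bcommute Q S ->
  (forall x, Q (F (Q x)) = F (Q x)) ->
  (forall x, quasinilpotent_part S (Q x)) ->
  bounded_below_on S [set x | E x = x /\ Q x = 0] ->
  exists Q', [/\ forall x, Q' (Q' x) = Q' x, forall x, Q' (E x) = Q' x,
    forall x, E (Q' x) = Q' x, bcommute Q' (badd S F) &
    (forall x, quasinilpotent_part (badd S F) (Q' x)) /\
    bounded_below_on (badd S F) [set x | E x = x /\ Q' x = 0]].
Proof.
move=> FS Fv vF EE ES EF FkE QQ QE EQ QS QFQ QH Sbelow.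
pose M := [set x | E x = x /\ Q x = 0].
pose S' := badd S F.
have S'E x : S' x = S x + F x by [].
pose B := badd S' (bopp (bcomp Q S')).
have BE x : B x = S' x - Q (S' x) by [].
have linM : linear_subspace M.
  split; first by rewrite inE; split; rewrite raddf0.
  move=> a x y; rewrite !inE => -[Ex Qx] [Ey Qy]; split; rewrite linearP.
    by rewrite -[LHS]/(a *: E x + E y) Ex Ey.
  by rewrite -[LHS]/(a *: Q x + Q y) Qx Qy scaler0 addr0.
have ES' : bcommute E S' by move=> x; rewrite !S'E raddfD /= ES EF.
have QS'Q x : Q (S' (Q x)) = S' (Q x).
  by rewrite S'E raddfD /= QFQ QS QQ.
have QS'M x : M x -> Q (S' x) = Q (F x).
  by move=> [_ Qx]; rewrite S'E raddfD /= QS Qx raddf0 add0r.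
(* the compression of F to ker Q, nilpotent because F leaves ran Q invariant *)
pose A := badd F (bopp (bcomp Q F)).
have AE x : A x = F x - Q (F x) by [].
have MA x : M x -> M (A x).
  move=> [Ex Qx]; split; rewrite AE raddfB /=; last by rewrite QQ subrr.
  by rewrite EQ EF Ex.
have AS : bcommute A S by move=> x; rewrite !AE FS QS raddfB.
have itA x j : M x -> iter j A x = iter j F x - Q (iter j F x).
  move=> [Ex Qx]; elim: j => [|j IH]; first by rewrite /= Qx subr0.
  rewrite iterS IH AE (raddfB F) (raddfB Q) /= QFQ.
  by rewrite opprB addrA subrK.
have [KB KB0 Bbelow] : bounded_below_on B M.
  have [K K0 h] := bounded_below_nilpotent k MA AS Sbelow.
  exists K => // x Mx; have -> : B x = badd S A x.
    by rewrite BE QS'M// /= addrA.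
  apply: h; split => //; rewrite itA//; case: Mx => <- _.
  by rewrite FkE raddf0 subrr.
pose w i := Q (v i); pose W := span (fun i : 'I_n => w i).
have linW : linear_subspace W by exact: span_subspace.
have QFW x : W (Q (F x)).
  have [c ->] := Fv x; rewrite raddf_sum; exists c.
  by apply: eq_bigr => i _; exact: (linearZ_LR Q).
have [N S'N] : exists N, forall x, W x -> iter N S' x = 0.
  have [||p Sp] := @quasinilpotent_span_nilpotent S n (fun i : 'I_n => w i).
  - move=> i; rewrite /w; have [y ->] := vF i.
    by rewrite -QS -FS; exact: QFW.
  - apply: span_sub; first exact: quasinilpotent_part_subspace.
    by move=> i; exact: QH.
  exists (p + k)%N => x Wx; apply: iter_add_nilpotent => //; first exact: Sp.
  have <- : E x = x; last exact: FkE.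
  apply/eqP; rewrite -subr_eq0 -opprB oppr_eq0; apply/eqP.
  apply: (span_sub _ _ Wx (A := [set x | badd bid (bopp E) x = 0])).
    exact: ker_subspace.
  by move=> i; rewrite /= /w EQ subrr.
have QW x : W x -> Q x = x.
  move=> Wx; apply/eqP; rewrite -subr_eq0 -opprB oppr_eq0; apply/eqP.
  apply: (span_sub _ _ Wx (A := [set x | badd bid (bopp Q) x = 0])).
    exact: ker_subspace.
  by move=> i; rewrite /= /w QQ subrr.
have next (D : bop X) : exists D' : bop X, (forall x, W (D x)) ->
    (forall x, M x -> D' (B x) = D x) /\ forall x, W (D' x).
  have [WD|nWD] := pselect (forall x, W (D x)); last by exists bzero.
  by have [D' h1 h2] := finite_rank_extension linM KB0 Bbelow WD; exists D'.
have [f fP] := choice next.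
pose D j := iter j f (bcomp Q F).
have DW j x : W (D j x).
  elim: j x => [|j IH] x; first exact: QFW.
  by have [_ h] := fP (D j) IH; exact: h.
have DB j x : M x -> D j.+1 (B x) = D j x.
  by have [h _] := fP (D j) (DW j); exact: h.
pose Z := bsum N (fun j => bcomp (bpow S' j) (D j.+1)).
have ZE x : Z x = \sum_(j < N) iter j S' (D j.+1 x).
  by rewrite bsumE; apply: eq_bigr => j _; rewrite /= bpowE.
have ZB x : M x -> Z (B x) = Q (F x) + S' (Z x).
  move=> Mx; rewrite !ZE raddf_sum /=.
  under eq_bigr do rewrite DB//.
  have <- : \sum_(j < N.+1) iter j S' (D j x) = \sum_(j < N) iter j S' (D j x).
    by rewrite big_ord_recr /= (S'N _ (DW N x)) addr0.
  by rewrite big_ord_recl.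
have QZ x : Q (Z x) = Z x.
  rewrite ZE raddf_sum; apply: eq_bigr => j _ /=.
  elim: (j : nat) (D _ x) (QW _ (DW j.+1 x)) => //= i IH y Qy.
  by rewrite -IH// QS'Q.
have EZ x : E (Z x) = Z x by rewrite -QZ EQ.
have ME x : M (E x - Q x).
  by split; rewrite raddfB /= ?EE ?EQ ?QE ?QQ ?subrr.
pose Q' := badd Q (bopp (bcomp Z (badd E (bopp Q)))).
have Q'E x : Q' x = Q x - Z (E x - Q x) by [].
have QQ' x : Q (Q' x) = Q' x by rewrite Q'E raddfB /= QQ QZ.
have EQ' x : E (Q' x) = Q' x by rewrite -QQ' EQ.
(* block triangularity: B describes S + F modulo the range of Q *)
have S'split x : E (S' x) - Q (S' x) = B (E x - Q x).
  have QS'E : Q (S' x) = Q (S' (E x)) by rewrite -[in LHS]QE ES'.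
  rewrite ES' QS'E BE (raddfB S') (raddfB Q).
  rewrite -[RHS]/(S' (E x) - S' (Q x) - (Q (S' (E x)) - Q (S' (Q x)))) QS'Q.
  by rewrite opprB addrA subrK.
exists Q'; split => //.
- by move=> x; rewrite [LHS]Q'E QQ' EQ' subrr raddf0 subr0.
- by move=> x; rewrite [LHS]Q'E QE EE.
- move=> x; rewrite -/S' [LHS]Q'E S'split ZB ?ME// opprD addrA Q'E (raddfB S').
  rewrite -[RHS]/(S' (Q x) - S' (Z (E x - Q x))); congr (_ - _).
  have -> : Q (S' x) = Q (S' (E x - Q x)) + Q (S' (Q x)).
    by rewrite -QE ES' -(raddfD Q) -(raddfD S') subrK.
  by rewrite QS'Q QS'M ?ME// addrAC subrr add0r.
split.
  move=> x; apply: (@quasinilpotent_part_perturb _ _ _ _ k) => //.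
  - by rewrite -EQ' FkE.
  - by rewrite -QQ'.
have [CZ CZ0 ZC] := bop_bounded Z; have [CQ CQ0 QC] := bop_bounded Q.
exists ((1 + CZ) * KB * (1 + CQ)).
  by rewrite !mulr_ge0 ?addr_ge0.
move=> x [Ex Q'x]; set m := E x - Q x.
have xE : x = m + Z m.
  have := Q'x; rewrite Q'E -/m => /eqP; rewrite subr_eq0 => /eqP <-.
  by rewrite /m subrK.
rewrite {1}xE (le_trans (rnormD _ _))//.
rewrite (@le_trans _ _ ((1 + CZ) * rnorm m))//.
  by rewrite mulrDl mul1r lerD2l.
rewrite -!mulrA ler_wpM2l ?addr_ge0//.
rewrite (le_trans (Bbelow m (ME x)))// ler_wpM2l// -S'split.
rewrite ES' Ex (le_trans (rnorm_sub _ _))// mulrDl mul1r lerD2l.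
exact: QC.
Qed.

(** Iterating the lower bound on ker P gives |x| <= K^n |S^n x|; hence ran P is
    all of the quasinilpotent part. *)
Lemma ker_lgD_projection S P x : lgD_projection S P ->
  P x = 0 -> quasinilpotent_part S x -> x = 0.
Proof.
move=> [PP PS PH [K K0 below]] Px.
apply: (@quasinilpotent_part_eq0 _ _ S K x K0).
elim=> [|n IH]; first by rewrite expr0 mul1r.
rewrite exprSr -mulrA (le_trans IH)// ler_wpM2l ?exprn_ge0//.
by apply: below; rewrite /= bcommute_iter// Px -bpowE raddf0.
Qed.

Lemma lgD_projection_id S P x : lgD_projection S P ->
  quasinilpotent_part S x -> P x = x.
Proof.
move=> SP; have [PP PS PH _] := SP => Hx; apply/eqP; rewrite eq_sym -subr_eq0.
apply/eqP/(ker_lgD_projection SP); first by rewrite raddfB /= PP subrr.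
by apply: (subspaceB (quasinilpotent_part_subspace S)).
Qed.

(** The finite-dimensional part where F is invertible is split off and
    decomposed on its own; on its complement F is nilpotent. *)
Lemma lgD_projection_perturb S F P n (v : nat -> X) :
  lgD_projection S P -> bcommute F S ->
  (forall x, span (fun i : 'I_n => v i) (F x)) ->
  (forall i, exists y, v i = F y) ->
  exists P', lgD_projection (badd S F) P'.
Proof.
move=> SP FS Fv vF; have [PP PS PH [K K0 below]] := SP.
have [k [pi [piC pipi Fk _ piv]]] := fitting_projection Fv.
have SF : bcommute S F by move=> x; rewrite FS.
have piS : bcommute S pi by exact: piC.
have piF : bcommute F pi by exact: piC.
pose E := badd bid (bopp pi).
have EE x : E x = x - pi x by [].
have EEE x : E (E x) = E x by rewrite !EE raddfB /= pipi subrr subr0.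
have ES : bcommute E S by move=> x; rewrite !EE raddfB /= piS.
have EF : bcommute E F by move=> x; rewrite !EE raddfB /= piF.
have FkE x : iter k F (E x) = 0 by exact: Fk.
have PEP x : P (E (P x)) = E (P x).
  by apply: (lgD_projection_id SP); exact: (quasinilpotent_part_commute ES (PH _)).
(* P need not commute with E, but ran P is invariant under E, which makes
   E P E idempotent *)
pose Q := bcomp E (bcomp P E).
have QE' x : Q x = E (P (E x)) by [].
have QH x : quasinilpotent_part S (Q x).
  exact: (quasinilpotent_part_commute ES (PH _)).
have QHE x : quasinilpotent_part S x -> E x = x -> Q x = x.
  by move=> Hx Ex; rewrite QE' Ex (lgD_projection_id SP).
have EQ x : E (Q x) = Q x by exact: EEE.
have [|||||||Q' [Q'Q' Q'E EQ' Q'S [Q'H [K1 K10 Q'below]]]] :=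
  @nilpotent_perturbation S F Q E n v k FS Fv vF EEE ES EF FkE.
- by move=> x; exact: QHE.
- by move=> x; rewrite !QE' EEE.
- exact: EQ.
- by move=> x; rewrite !QE' ES PS ES.
- move=> x; apply: QHE; first exact: (quasinilpotent_part_commute FS (QH _)).
  by rewrite EF EQ.
- exact: QH.
- have [CP CP0 PC] := bop_bounded P; have [CE CE0 EC] := bop_bounded E.
  exists (CE * (K * (1 + CP))); first by rewrite !mulr_ge0 ?addr_ge0.
  move=> x [Ex Qx].
  have {1}-> : x = E (x - P x).
    have EPx : E (P x) = 0 by rewrite -Qx QE' Ex.
    by rewrite (raddfB E) -[RHS]/(E x - E (P x)) EPx subr0 Ex.
  rewrite (le_trans (EC _))// -!mulrA ler_wpM2l//.
  have Pm : P (x - P x) = 0 by rewrite raddfB /= PP subrr.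
  rewrite (le_trans (below _ Pm))// ler_wpM2l// raddfB /= -PS.
  rewrite (le_trans (rnorm_sub _ _))// mulrDl mul1r lerD2l.
  exact: PC.
pose S' := badd S F.
have S'E x : S' x = S x + F x by [].
have piS' x : pi (S' x) = S' (pi x) by rewrite !S'E raddfD /= piS piF.
(* S' pi has finite rank, so its Fitting projection pi2 splits ran pi into a
   part where S' is nilpotent and a part where S' is invertible *)
pose G := bcomp S' pi.
have GE x : G x = S' (pi x) by [].
have Gv x : span (fun i : 'I_n => v i) (G x) by rewrite GE -piS'.
have [k2 [pi2 [pi2C pi2pi2 Gk [K2 K20 Gbelow] _]]] := fitting_projection Gv.
have pi2S' : bcommute S' pi2 by apply: pi2C => x; rewrite !GE piS'.
have pipi2 : bcommute pi pi2 by apply: pi2C => x; rewrite !GE piS' pipi.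
have pi2G : bcommute G pi2 by exact: pi2C.
have pi2pi x : pi2 (pi x) = pi2 x.
  apply/eqP; rewrite eq_sym -subr_eq0 -raddfB; apply/eqP/rnorm0_eq0/le_anti.
  rewrite rnorm_ge0 andbT (le_trans (Gbelow _))// pi2G GE.
  have -> : pi (x - pi x) = 0 by rewrite raddfB /= pipi subrr.
  by rewrite (raddf0 S') (raddf0 pi2) rnorm0 mulr0.
have piE x : pi (E x) = 0 by rewrite EE raddfB /= pipi subrr.
have Epi x : E (pi x) = 0 by rewrite EE pipi subrr.
have piQ' x : pi (Q' x) = 0 by rewrite -EQ' piE.
have Q'pi x : Q' (pi x) = 0 by rewrite -Q'E Epi raddf0.
(* the nilpotent part of ran pi joins the range of the new projection *)
pose Y := badd pi (bopp pi2).
have YE x : Y x = pi x - pi2 x by [].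
have piY x : pi (Y x) = Y x by rewrite YE raddfB /= pipi pipi2 pi2pi.
have pi2Y x : pi2 (Y x) = 0 by rewrite YE raddfB /= pi2pi pi2pi2 subrr.
have YY x : Y (Y x) = Y x by rewrite [LHS]YE piY pi2Y subr0.
have YQ' x : Y (Q' x) = 0 by rewrite YE piQ' -pi2pi piQ' raddf0 subrr.
have Q'Y x : Q' (Y x) = 0 by rewrite -piY Q'pi.
exists (badd Q' Y); rewrite -/S'.
have P'E x : badd Q' Y x = Q' x + Y x by [].
split.
- move=> x; rewrite !P'E (raddfD Q') (raddfD Y).
  rewrite -[LHS]/(Q' (Q' x) + Q' (Y x) + (Y (Q' x) + Y (Y x))).
  by rewrite Q'Q' YY YQ' Q'Y addr0 add0r.
- move=> x; rewrite !P'E Q'S -/S' (raddfD S').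
  rewrite -[RHS]/(S' (Q' x) + S' (Y x)); congr (_ + _).
  rewrite !YE (raddfB S') -[RHS]/(S' (pi x) - S' (pi2 x)).
  by rewrite piS' pi2S'.
- move=> x; have linH := quasinilpotent_part_subspace S'.
  apply: (subspaceD linH); first exact: Q'H.
  apply: (@quasinilpotent_part_nilpotent _ _ _ k2).
  suff <- : iter k2 G (Y x) = iter k2 S' (Y x).
    by rewrite YE -[in X in _ - X]pi2pi; exact: Gk.
  elim: (k2) => // j IH; rewrite 2!iterS IH GE; congr (S' _).
  by rewrite bcommute_iter// piY.
have [CE CE0 EC] := bop_bounded E; have [Cp Cp0 piCb] := bop_bounded pi.
exists (K1 * CE + K2 * Cp); first by rewrite addr_ge0// mulr_ge0.
move=> x P'x.
have Q'x : Q' x = 0.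
  have := congr1 Q' P'x; rewrite (raddfD Q') (raddf0 Q').
  by rewrite -[LHS]/(Q' (Q' x) + Q' (Y x)) Q'Q' Q'Y addr0.
have pix : pi x = pi2 x.
  by move: P'x; rewrite /mkset P'E Q'x add0r YE => /eqP; rewrite subr_eq0 => /eqP.
have {1}-> : x = E x + pi x by rewrite EE subrK.
rewrite (le_trans (rnormD _ _))// mulrDl lerD//.
  have ES' : S' (E x) = E (S' x).
    by rewrite !S'E (raddfD E) -[RHS]/(E (S x) + E (F x)) ES EF.
  rewrite (le_trans (Q'below (E x) _))//; first by split; rewrite ?EEE ?Q'E.
  by rewrite -mulrA ler_wpM2l// -/S' ES'.
rewrite pix (le_trans (Gbelow x))// -mulrA ler_wpM2l//.
by rewrite GE pipi2 pi2pi -pix -piS'.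
Qed.

End Perturbation.

(** * Left generalized Drazin invertibility through projections *)

Section Characterization.
Context {R : realType} {X : completeNormedModType R[i]}.
Implicit Types S T F P : bop X.

Lemma tends_bop T (u : nat -> X) l : tends u l -> tends (fun n => T (u n)) (T l).
Proof.
move=> ul e e0; have [C C0 TC] := bop_bounded T.
have C1 : 0 < C + 1 by rewrite ltr_wpDl.
have [|N uN] := ul (e / (C + 1)); first by rewrite divr_gt0.
exists N => n /uN un; rewrite -raddfB (le_trans (TC _))//.
rewrite (@le_trans _ _ ((C + 1) * rnorm (u n - l)))//.
  by rewrite ler_wpM2r ?rnorm_ge0// lerDl.
by rewrite mulrC -ler_pdivlMr.
Qed.

Lemma ker_closed T : closed [set x | T x = 0].
Proof.
apply: approx_closed => x xT; have [C C0 TC] := bop_bounded T.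
apply: (@rnorm_small0 _ _ _ C) => e /xT[a Ta xa].
have -> : T x = T (x - a) by rewrite raddfB /= [T a]Ta subr0.
by rewrite (le_trans (TC _))// ler_wpM2l.
Qed.

Lemma inv_exp2_small (b e : R) : 0 < e -> exists n, b / 2 ^+ n <= e.
Proof.
move=> e0; have /cvgrPdist_le/(_ e e0)[n _ /(_ n (leqnn n))] :
    geometric b (2^-1 : R) @ \oo --> (0 : R).
  by apply: cvg_geometric; rewrite ger0_norm ?invr_ge0// invf_lt1// ltr1n.
rewrite /= sub0r normrN exprVn => /(le_trans (ler_norm _)) h; by exists n.
Qed.

Lemma bounded_below_closed_image S (M : set X) :
  linear_subspace M -> closed M -> bounded_below_on S M -> closed (S @` M).
Proof.
move=> linM cM [K K0 SK]; apply: approx_closed => y ySM.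
have /choice[u uP] : forall n, exists x, M x /\ rnorm (y - S x) <= 1 / 2 ^+ n.
  move=> n; have [|_ [x Mx <-] yx] := ySM (1 / 2 ^+ n).
    by rewrite divr_gt0// exprn_gt0.
  by exists x.
have [||l ul _] := @tends_geometric _ _ u (K * 2).
- by rewrite mulr_ge0.
- move=> n; have [Mu yu] := uP n; have [Mu1 yu1] := uP n.+1.
  rewrite (le_trans (SK _ _))//; first exact: (subspaceB linM).
  rewrite -!mulrA ler_wpM2l//.
  have -> : S (u n.+1 - u n) = S (u n.+1) - S (u n) by rewrite raddfB.
  rewrite (le_trans (rnorm_dist _ y _))//.
  have hn : 1 / 2 ^+ n.+1 <= 1 / 2 ^+ n :> R.
    by rewrite ler_pM2l// lef_pV2 ?posrE ?exprn_gt0// ler_eXn2l ?ltr1n.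
  rewrite (rnormB (S (u n.+1))); lra.
exists l; first by apply: closed_tends ul => // n; case: (uP n).
apply: tends_unique (tends_bop S ul) _ => e /(inv_exp2_small 1)[N hN].
exists N => n Nn; have [_ yu] := uP n; rewrite rnormB (le_trans yu)//.
rewrite (le_trans _ hN)// ler_pM2l// lef_pV2 ?posrE ?exprn_gt0//.
by rewrite ler_eXn2l ?ltr1n.
Qed.

Lemma lgD_projection_invertible S P : lgD_projection S P -> lgD_invertible S.
Proof.
move=> SP; have [PP PS PH below] := SP.
have HE : quasinilpotent_part S = [set x | badd bid (bopp P) x = 0].
  apply/seteqP; split => x /=.
    by move=> /(lgD_projection_id SP) ->; rewrite subrr.
  by move=> /eqP; rewrite subr_eq0 => /eqP ->; exact: PH.
split; first by rewrite HE; exact: ker_closed.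
exists [set x | P x = 0]; split.
- exact: ker_subspace.
- exact: ker_closed.
- split.
    apply/seteqP; split => x.
      by move=> [Px Hx]; exact: (ker_lgD_projection SP Px Hx).
    move=> ->; split; first by rewrite /mkset raddf0.
    exact: subspace0 (quasinilpotent_part_subspace S).
  move=> x; exists (x - P x), (P x); split => //; last by rewrite subrK.
  by rewrite /mkset raddfB /= PP subrr.
- by move=> _ [x Px <-]; rewrite /mkset PS [P x]Px raddf0.
- apply: bounded_below_closed_image => //; [exact: ker_subspace|exact: ker_closed].
Qed.

(** Both closed graph arguments happen here: boundedness of the projection along
    M, and boundedness of the inverse g of the restriction of S to M. *)
Lemma lgD_invertible_projection S :
  lgD_invertible S -> exists P, lgD_projection S P.
Proof.
move=> [cH [M [linM cM [MH0 MH] SM cSM]]].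
set H := quasinilpotent_part S in cH MH0 MH.
have linH : linear_subspace H := quasinilpotent_part_subspace S.
have MH_eq0 x : M x -> H x -> x = 0.
  by move=> Mx Hx; have : (M `&` H) x by []; rewrite MH0.
have /choice[p pP] : forall x, exists h, H h /\ M (x - h).
  by move=> x; have [m [h [Mm Hh ->]]] := MH x; exists h; split; rewrite ?addrK.
have p_unique x h : H h -> M (x - h) -> p x = h.
  move=> Hh Mh; have [Hp Mp] := pP x; apply/eqP; rewrite -subr_eq0.
  apply/eqP/MH_eq0; last exact: (subspaceB linH).
  have -> : p x - h = (x - h) - (x - p x) by rewrite opprB [RHS]addrC addrA subrK.
  exact: (subspaceB linM).
have p_lin : linear p.
  move=> a x y; have [Hx Mx] := pP x; have [Hy My] := pP y.
  apply: p_unique; first exact: (subspace_comb linH).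
  by rewrite opprD addrACA -scalerBr; exact: (subspace_comb linM).
have [||||C C0 pC] := @closed_graph _ _ setT p.
- exact: closedT.
- by split; [rewrite inE|move=> a x y _ _; rewrite inE].
- by move=> a x y _ _; exact: p_lin.
- move=> u l m _ ul pum; apply: p_unique.
    by apply: closed_tends pum => // n; case: (pP (u n)).
  apply: (closed_tends (u := fun n => u n - p (u n))) => //.
    by move=> n; case: (pP (u n)).
  exact: tends_sub.
have [P PE] : exists P : bop X, P =1 p.
  have pB : exists2 C : R, 0 <= C & forall x, rnorm (p x) <= C * rnorm x.
    by exists C => // x; exact: pC.
  by exists (Bop p_lin pB).
have pid x : H x -> p x = x.
  by move=> Hx; apply: p_unique; rewrite // subrr; exact: subspace0.
have ker_p x : p x = 0 -> M x.
  by move=> px; have [_] := pP x; rewrite px subr0.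
have SI x y : M x -> M y -> S x = S y -> x = y.
  move=> Mx My Sxy; apply/subr0_eq/MH_eq0; first exact: (subspaceB linM).
  by apply: (@quasinilpotent_part_nilpotent _ _ _ 1); rewrite /= raddfB /= Sxy subrr.
have /choice[g gP] : forall y, exists x, forall x', M x' -> S x' = y -> x = x'.
  move=> y; have [[x [Mx xy]]|nx] := pselect (exists x, M x /\ S x = y).
    by exists x => x' Mx' x'y; apply: SI => //; rewrite xy.
  by exists 0 => x' Mx' x'y; case: nx; exists x'.
have gS x : M x -> g (S x) = x by move=> Mx; exact: gP.
have [||||D D0 gD] := @closed_graph _ _ (S @` M) g.
- exact: cSM.
- split; first by rewrite inE; exists 0; [exact: subspace0|rewrite raddf0].
  move=> a x y; rewrite !inE => -[x' Mx <-] [y' My <-].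
  by exists (a *: x' + y'); [exact: (subspace_comb linM)|rewrite linearP].
- move=> a _ _ [x' Mx <-] [y' My <-]; rewrite -linearP !gS//.
  exact: (subspace_comb linM).
- move=> u l m uSM ul gum; apply: gP.
    apply: closed_tends gum => // n; have [x Mx <-] := uSM n.
    by rewrite gS.
  apply: tends_unique ul; have := tends_bop S gum.
  have -> // : (fun n => S (g (u n))) = u.
  by apply/funext => n; have [x Mx <-] := uSM n; rewrite gS.
exists P; split.
- by move=> x; rewrite !PE; apply: pid; case: (pP x).
- move=> x; rewrite !PE; have [Hx Mx] := pP x; apply: p_unique.
    exact: quasinilpotent_part_commute Hx.
  by rewrite -raddfB; apply: SM; exists (x - p x).
- by move=> x; rewrite PE; case: (pP x).
- exists D => // x /=; rewrite PE => /ker_p Mx.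
  rewrite -{1}(gS x Mx); apply: gD; by exists x.
Qed.

Lemma lgD_invertible_perturb S F n (v : nat -> X) :
  bcommute F S ->
  (forall x, span (fun i : 'I_n => v i) (F x)) ->
  (forall i, exists y, v i = F y) ->
  lgD_invertible S -> lgD_invertible (badd S F).
Proof.
move=> FS Fv vF /lgD_invertible_projection[P SP].
have [P' SP'] := lgD_projection_perturb SP FS Fv vF.
exact: lgD_projection_invertible SP'.
Qed.

Lemma bounded_operator_bop (T : {linear X -> X}) :
  bounded_operator T -> exists S : bop X, S =1 T.
Proof.
move=> [c Tc]; have Tlin : linear T by move=> a x y; rewrite linearP.
suff TB : exists2 C : R, 0 <= C & forall x, rnorm (T x) <= C * rnorm x.
  by exists (Bop Tlin TB).
exists `|complex.Re c| => // x; have := Tc x; rewrite !rnormE lecE => /andP[_].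
case: (c) => a b /=; rewrite mulr0 subr0 => /le_trans; apply.
by rewrite ler_wpM2r ?rnorm_ge0// ler_norm.
Qed.

End Characterization.

Theorem proposition3p14 (R : realType) (X : completeNormedModType R[i])
    (T F : {linear X -> X}) :
  ~ finite_dimensional [set: X] ->
  bounded_operator T ->
  bounded_operator F ->
  finite_rank F ->
  T \o F = F \o T ->
  lgD_spectrum (T \+ F) = lgD_spectrum T.
Proof.
move=> _ /bounded_operator_bop[T' T'E] /bounded_operator_bop[F' F'E].
move=> [n [v rangeF]] TF.
have {}TF x : T' (F' x) = F' (T' x).
  by rewrite !T'E !F'E -[T (F x)]/((T \o F) x) TF.
(* spanning vectors of the range of F, padded by 0, which lies in it too *)
pose w (i : nat) : X := if insub i is Some j then v j else 0.
have wE (j : 'I_n) : w j = v j by rewrite /w valK.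
have Fw x : span (fun i : 'I_n => w i) (F' x).
  have : range F (F x) by exists x.
  rewrite rangeF F'E => -[c _ <-]; exists c.
  by apply: eq_bigr => i _; rewrite wE.
have wF i : exists y, w i = F' y.
  rewrite /w; case: insubP => [j _ _|_]; last by exists 0; rewrite raddf0.
  have : range F (v j).
    rewrite rangeF; have [c cE] := span_gen v j; by exists c.
  by move=> [y _ <-]; exists y.
pose S l := badd (bscale l bid) (bopp T').
have SE l : (fun x => l *: x - T x) = S l.
  by apply/funext => x; rewrite /= T'E.
have SFE l : (fun x => l *: x - (T \+ F) x) = badd (S l) (bopp F').
  by apply/funext => x; rewrite /= T'E F'E opprD addrA.
have S_SF l : (S l : X -> X) = badd (badd (S l) (bopp F')) F'.
  by apply/funext => x; rewrite /= subrK.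
have FS l : bcommute F' (S l).
  by move=> x; rewrite /= raddfB /= linearZ /= TF.
have nFS l : bcommute (bopp F') (S l).
  move=> x; rewrite -[LHS]/(- F' (S l x)) FS.
  by rewrite -[RHS]/(S l (- F' x)) raddfN.
have FSF l : bcommute F' (badd (S l) (bopp F')).
  move=> x; rewrite -[LHS]/(F' (S l x - F' x)) raddfB.
  by rewrite -[LHS]/(F' (S l x) - F' (F' x)) FS.
apply/seteqP; split => l; rewrite /lgD_spectrum /= SE SFE; apply: contra_not.
  apply: (@lgD_invertible_perturb _ _ _ (bopp F') n w) => //.
    move=> x; rewrite -[bopp F' x]/(- F' x) -scaleN1r.
    exact: (subspaceZ (span_subspace _)).
  move=> i; have [y ->] := wF i; exists (- y).
  by rewrite -[RHS]/(- F' (- y)) raddfN /= opprK.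
by rewrite S_SF; exact: (lgD_invertible_perturb (FSF l) Fw wF).
Qed.
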